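(* Let $\mathbb{F}$ be an algebraically closed field with $\mathrm{char}\,\mathbb{F}\neq 2$, $G$ an abelian group and $n\geq 1$. Every odd $G$-grading on the associative superalgebra $M(n,n)$ is isomorphic to some $\Gamma(t_0,\overline{T},\overline{\beta},u,\gamma)$. Two odd gradings, $\Gamma(t_0,\overline{T},\overline{\beta},u,\gamma)$ and $\Gamma(t_0',\overline{T}',\overline{\beta}',u',\gamma')$, on $M(n,n)$ are isomorphic if, and only if, $t_0=t_0'$, $\overline{T}=\overline{T}'$, $\overline{\beta}=\overline{\beta}'$, $u\equiv u'\pmod{\langle t_0\rangle}$, and there is $g\in G$ such that $g\,\Xi(\gamma)=\Xi(\gamma')$.
   Context: $M(n,n)$ is the associative superalgebra $M_{2n}(\mathbb{F})=\mathrm{End}(\mathbb{F}^n\oplus\mathbb{F}^n)$ whose even (odd) part consists of the block-diagonal (block-off-diagonal) matrices. A $G$-grading on a superalgebra $A=A^{\bar 0}\oplus A^{\bar 1}$ is a decomposition $A=\bigoplus_{g\in G}A_g$ with $A_gA_h\subseteq A_{gh}$ and $A_g=(A_g\cap A^{\bar 0})\oplus(A_g\cap A^{\bar 1})$. Two $G$-gradings on $A$ are isomorphic if some automorphism of the superalgebra $A$ maps each component of the first onto the component of the second of the same degree. Graded division algebras. A graded division algebra is a graded unital associative algebra in which every nonzero homogeneous element is invertible. For an abelian group $K$, finite-dimensional $K$-graded division algebras $D$ that are simple as algebras correspond, up to isomorphism, to pairs $(T,\beta)$: $T=\mathrm{supp}\,D$ is a finite subgroup of $K$, all $D_t$ ($t\in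 T$) are one-dimensional, and $\beta$ is the nondegenerate alternating bicharacter $T\times T\to\mathbb{F}^\times$ with $X_uX_v=\beta(u,v)X_vX_u$ for $X_u\in D_u$, $X_v\in D_v$. Odd gradings. Put $G^\#=G\times\mathbb{Z}_2$, let $p:G^\#\to\mathbb{Z}_2$ be the projection, and identify $G$ with $G\times\{\bar 0\}$. A $G$-grading on $M(n,n)$, viewed as a $G^\#$-grading, makes it isomorphic to $\mathrm{End}_D(\mathcal{U})$ for a $G^\#$-graded division algebra $D$ and a $G^\#$-graded right $D$-module $\mathcal{U}$ of finite rank; the grading is odd if $\mathrm{supp}\,D$ is not contained in $G\times\{\bar 0\}$. Parameters. Let $t_0\in G$ be an element of order $2$, $\overline{G}=G/\langle t_0\rangle$, $\overline{T}\subseteq\overline{G}$ a finite subgroup, $\overline{\beta}$ a nondegenerate alternating bicharacter on $\overline{T}$, $T^+\subseteq G$ the inverse image of $\overline{T}$ and $\beta^+(s,t)=\overline{\beta}(\overline{s},\overline{t})$ for $s,t\in T^+$. For each pair $(t_0,\overline{T})$ a character $\chi:T^+\to\mathbb{F}^\times$ with $\chi(t_0)=-1$ is fixed once and for all. Since $\chi^2(t_0)=1$, $\chi^2$ is a character of $\overline{T}$; let $a$ be the unique element of $T^+$ such that $\chi(a)=1$ and $\chi^2(\overline{t})=\overline{\beta}(\overline{a},\overline{t})$ for all $t\in T^+$. The parameter $u$ is an element of $G$ with $u^2=a$. For such $u$, put $t_1=(u,\bar 1)\in G^\#$ and $T_u=T^+\cup t_1T^+$, a subgroup of $G^\#$,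 and let $\beta_u$ be the unique nondegenerate alternating bicharacter on $T_u$ extending $\beta^+$ with $\beta_u(t_1,t)=\chi(t)$ for all $t\in T^+$. Finally $\gamma=(g_1,\dots,g_k)$ is a $k$-tuple of elements of $G$ with $k\sqrt{|\overline{T}|}=n$. The grading $\Gamma(t_0,\overline{T},\overline{\beta},u,\gamma)$. Let $D$ be the $G^\#$-graded division algebra associated to $(T_u,\beta_u)$. The algebra $M_k(\mathbb{F})\otimes D$ (which is $\mathrm{End}_D$ of the graded right $D$-module with a homogeneous basis of degrees $g_1,\dots,g_k$) is $G^\#$-graded by $\deg(E_{ij}\otimes d)=g_i(\deg d)g_j^{-1}$, hence is a superalgebra via $p$; it is isomorphic to $M(n,n)$ as a superalgebra. $\Gamma(t_0,\overline{T},\overline{\beta},u,\gamma)$ is the corresponding $G$-grading on $M(n,n)$ (defined up to isomorphism). $\Xi(\gamma)$ is the multiset in $G^\#/T_u\cong G/T^+$ of the cosets of $g_1,\dots,g_k$, counted with multiplicity; $G$ acts on such multisets by multiplication. *)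

(* Defs.v *)
(* The abelian groups G, G# = G x Z_2 and
   G/<t0> are zmodTypes and hence written additively.  Finite-dimensional
   algebras are falgTypes.  Bicharacters and characters are functions defined
   on the whole ambient group, of which only the values on the relevant
   subgroup T matter. *)
From HB Require Import structures.
From mathcomp Require Import all_boot all_order all_algebra all_field.
From mathcomp Require Import ring_quotient finmap boolp.

Set Implicit Arguments.
Unset Strict Implicit.
Unset Printing Implicit Defensive.

Import GRing.Theory.
Local Open Scope ring_scope.

Section GradedVectorSpaces.
Variables (F : fieldType) (K : zmodType).

(* V is the direct sum of the V_g: every vector lies in a finite partial sum
   and all the finite partial sums are direct. *)
Definition is_decomposition (V : vectType F) (Vg : K -> {vspace V}) : Prop :=
  (forall v : V, exists s : {fset K}, v \in (\sum_(g <- s) Vg g)%VS) /\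
  (forall s : {fset K}, directv (\sum_(g <- s) Vg g)).

(* The product is a parameter because 'M[F]_m is an falgType for nonzero m
   only in the form m'.+1. *)
Definition is_grading (V : vectType F) (mul : V -> V -> V)
    (Vg : K -> {vspace V}) : Prop :=
  is_decomposition Vg /\
  (forall g h x y, x \in Vg g -> y \in Vg h -> mul x y \in Vg (g + h)).

Definition graded_division (D : falgType F) (Dg : K -> {vspace D}) : Prop :=
  is_grading *%R Dg /\
  (forall g x, x \in Dg g -> x != 0 -> x \is a GRing.unit).

(* A right action of D on U is given by the linear map d |-> (v |-> v d). *)
Definition is_right_module (D : falgType F) (U : vectType F)
    (act : 'Hom(D, 'End(U))) : Prop :=
  act 1 = \1%VF /\ (forall d e, act (d * e) = (act e \o act d)%VF).

Definition is_graded_right_module (D : falgType F) (Dg : K -> {vspace D})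
    (U : vectType F) (act : 'Hom(D, 'End(U))) (Ug : K -> {vspace U}) : Prop :=
  [/\ is_right_module act,
      is_decomposition Ug
    & forall g h v d, v \in Ug g -> d \in Dg h -> act d v \in Ug (g + h)].

Definition in_EndD (D : falgType F) (U : vectType F)
    (act : 'Hom(D, 'End(U))) (f : 'End(U)) : Prop :=
  forall d v, f (act d v) = act d (f v).

Definition has_degree (U : vectType F) (Ug : K -> {vspace U}) (g : K)
    (f : 'End(U)) : Prop :=
  forall h v, v \in Ug h -> f v \in Ug (g + h).

Definition is_simple_algebra (D : falgType F) : Prop :=
  forall I : {vspace D},
    (forall d x, x \in I -> (d * x \in I) && (x * d \in I)) ->
    I = 0%VS \/ I = fullv.

Definition is_character (T : {pred K}) (c : K -> F) : Prop :=
  {in T, forall x, c x != 0} /\ {in T &, forall x y, c (x + y) = c x * c y}.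

Definition is_nondeg_alt_bichar (T : {pred K}) (b : K -> K -> F) : Prop :=
  [/\ {in T, forall x, is_character T (b x)},
      {in T, forall y, is_character T (fun x => b x y)},
      {in T, forall x, b x x = 1}
    & {in T, forall x, (forall y, y \in T -> b x y = 1) -> x = 0}].

(* (D, Dg) is the graded division algebra associated to (T, b). *)
Definition is_associated (T : {pred K}) (b : K -> K -> F)
    (D : falgType F) (Dg : K -> {vspace D}) : Prop :=
  [/\ graded_division Dg,
      is_simple_algebra D,
      forall t, (t \in T) = (Dg t != 0%VS),
      {in T, forall t, \dim (Dg t) = 1%N}
    & {in T &, forall s t, forall x y, x \in Dg s -> y \in Dg t ->
        x * y = b s t *: (y * x)}].

End GradedVectorSpaces.

Section SuperalgebraMnn.
Variables (F : fieldType) (G : zmodType) (n : nat).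
Local Notation M := 'M[F]_(n + n).
Local Notation Gsharp := (G * 'Z_2)%type.

Definition Mnn_part (i : 'Z_2) : {vspace M} :=
  if i == 0 then
    (lker (linfun (@ursubmx F n n n n)) :&: lker (linfun (@dlsubmx F n n n n)))%VS
  else
    (lker (linfun (@ulsubmx F n n n n)) :&: lker (linfun (@drsubmx F n n n n)))%VS.

Definition is_super_grading (A : G -> {vspace M}) : Prop :=
  is_grading (@mulmx F _ _ _) A /\
  (forall g, A g = (A g :&: Mnn_part 0%R + A g :&: Mnn_part 1%R)%VS).

Definition sharp (A : G -> {vspace M}) (x : Gsharp) : {vspace M} :=
  (A x.1 :&: Mnn_part x.2)%VS.

Definition gradings_isomorphic (A B : G -> {vspace M}) : Prop :=
  exists f : 'End(M),
    [/\ lker f == 0%VS,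
        forall x y, f (x *m y) = f x *m f y,
        forall i, (f @: Mnn_part i)%VS = Mnn_part i
      & forall g, (f @: A g)%VS = B g].

(* phi is an isomorphism of the G#-graded algebra (M(n,n), sharp A) onto
   End_D(U). *)
Definition is_iso_to_EndD (A : G -> {vspace M}) (D : falgType F)
    (U : vectType F) (act : 'Hom(D, 'End(U))) (Ug : Gsharp -> {vspace U})
    (phi : 'Hom(M, 'End(U))) : Prop :=
  [/\ lker phi == 0%VS,
      forall x y, phi (x *m y) = (phi x \o phi y)%VF,
      forall f, f \in limg phi <-> in_EndD act f
    & forall g x, x \in sharp A g <-> has_degree Ug g (phi x)].

Definition is_odd_grading (A : G -> {vspace M}) : Prop :=
  is_super_grading A /\
  exists (D : falgType F) (Dg : Gsharp -> {vspace D})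
         (U : vectType F) (act : 'Hom(D, 'End(U))) (Ug : Gsharp -> {vspace U})
         (phi : 'Hom(M, 'End(U))),
    [/\ graded_division Dg,
        is_graded_right_module Dg act Ug,
        is_iso_to_EndD A act Ug phi
      & ~ (forall t, Dg t != 0%VS -> t.2 = 0)].

End SuperalgebraMnn.

Section Quotient.
Variable G : zmodType.

Definition cyc (t0 : G) : {pred G} :=
  [pred x | `[< exists m : int, x = t0 *~ m >]].

Fact cyc_zmod_closed t0 : zmod_closed (cyc t0).
Proof.
split=> [|x y /asboolP[i ->] /asboolP[j ->]]; apply/asboolP.
  by exists 0; rewrite mulr0z.
by exists (i - j); rewrite mulrzBr.
Qed.

HB.instance Definition _ t0 :=
  GRing.isZmodClosed.Build G (cyc t0) (cyc_zmod_closed t0).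

Definition Gbar (t0 : G) : zmodType := Quotient.quot (cyc t0).

Definition bar (t0 : G) (x : G) : Gbar t0 :=
  (\pi_(Quotient.quot (cyc t0)) x)%qT.

Definition has_order2 (t0 : G) : Prop := t0 != 0 /\ t0 *+ 2 = 0.

Definition Tplus (t0 : G) (Tbar : {fset Gbar t0}) : {pred G} :=
  [pred x | bar t0 x \in Tbar].

Definition betaplus (F : fieldType) (t0 : G) (beta : Gbar t0 -> Gbar t0 -> F)
    (s t : G) : F := beta (bar t0 s) (bar t0 t).

End Quotient.

Section Gamma.
Variables (F : fieldType) (G : zmodType) (n : nat).
Local Notation Gsharp := (G * 'Z_2)%type.

(* chi is the character of T^+ fixed once and for all for each (t0, Tbar). *)
Variable chi : forall t0 : G, {fset Gbar t0} -> G -> F.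

Definition is_choice_of_characters : Prop :=
  forall (t0 : G) (Tbar : {fset Gbar t0}),
    has_order2 t0 -> zmod_closed [pred x in Tbar] ->
    is_character (Tplus Tbar) (chi Tbar) /\ chi Tbar t0 = -1.

Variables (t0 : G) (Tbar : {fset Gbar t0}) (beta : Gbar t0 -> Gbar t0 -> F).
Variables (u : G) (k : nat) (gamma : k.-tuple G).

Definition is_element_a (a : G) : Prop :=
  [/\ a \in Tplus Tbar,
      chi Tbar a = 1
    & {in Tplus Tbar, forall t, chi Tbar t ^+ 2 = betaplus beta a t}].

Definition admissible : Prop :=
  [/\ has_order2 t0,
      zmod_closed [pred x in Tbar],
      is_nondeg_alt_bichar [pred x in Tbar] beta,
      exists2 a, is_element_a a & u *+ 2 = a
    & exists2 l, (l ^ 2)%N = #|` Tbar| & (k * l)%N = n].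

Definition Tplus_sharp : {pred Gsharp} :=
  [pred x | (x.1 \in Tplus Tbar) && (x.2 == 0)].

Definition t1 : Gsharp := (u, 1).

Definition T_u : {pred Gsharp} :=
  [pred x | (x \in Tplus_sharp) || (x - t1 \in Tplus_sharp)].

Definition is_beta_u (b : Gsharp -> Gsharp -> F) : Prop :=
  [/\ is_nondeg_alt_bichar T_u b,
      {in Tplus Tbar &, forall s t, b (s, 0) (t, 0) = betaplus beta s t}
    & {in Tplus Tbar, forall t, b t1 (t, 0) = chi Tbar t}].

(* The homogeneous component of degree x of M_k(F) (x) D = 'M[D]_k, where
   E_ij (x) d has degree g_i + deg d - g_j. *)
Definition in_MkD_degree (D : falgType F) (Dg : Gsharp -> {vspace D})
    (x : Gsharp) (X : 'M[D]_k) : Prop :=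
  forall i j, X i j \in Dg (- (tnth gamma i, 0) + x + (tnth gamma j, 0)).

(* A is (in the isomorphism class of) the grading
   Gamma(t0, Tbar, beta, u, gamma): it corresponds to the G#-grading of
   M_k(F) (x) D under some isomorphism phi of superalgebras. *)
Definition is_Gamma (A : G -> {vspace 'M[F]_(n + n)}) : Prop :=
  is_super_grading A /\
  exists (b : Gsharp -> Gsharp -> F) (D : falgType F)
         (Dg : Gsharp -> {vspace D}) (phi : 'M[F]_(n + n) -> 'M[D]_k),
    [/\ is_beta_u b,
        is_associated T_u b Dg,
        bijective phi,
        [/\ forall x y, phi (x + y) = phi x + phi y,
            forall c x, phi (c *: x) = map_mx ( *:%R c) (phi x)
          & forall x y, phi (x *m y) = phi x *m phi y]
      & forall g x, x \in sharp A g <-> in_MkD_degree Dg g (phi x)].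

End Gamma.

(* The multiset Xi(gamma) of cosets of T, as its multiplicity function: the
   value at x is the multiplicity of the coset x + T. *)
Definition Xi (G : zmodType) (T : {pred G}) (gamma : seq G) (x : G) : nat :=
  count (fun y => y - x \in T) gamma.

Definition translate (G : zmodType) (g : G) (m : G -> nat) (x : G) : nat :=
  m (x - g).

(* Tbar and beta live over G/<t0>, so they are compared with Tbar' and beta'
   after transport along t0 = t0'. *)
Definition same_parameters (F : fieldType) (G : zmodType)
    (t0 : G) (Tbar : {fset Gbar t0}) (beta : Gbar t0 -> Gbar t0 -> F)
    (u : G) (gamma : seq G)
    (t0' : G) (Tbar' : {fset Gbar t0'}) (beta' : Gbar t0' -> Gbar t0' -> F)
    (u' : G) (gamma' : seq G) : Prop :=
  [/\ exists e : t0 = t0',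
        eq_rect t0 (fun t => {fset Gbar t}) Tbar t0' e = Tbar' /\
        {in Tbar' &, forall x y,
          eq_rect t0 (fun t => Gbar t -> Gbar t -> F) beta t0' e x y
          = beta' x y},
      u - u' \in cyc t0
    & exists g : G,
        translate g (Xi (Tplus Tbar) gamma) =1 Xi (Tplus Tbar') gamma'].

(* Main.v *)
(* The graded division algebra attached to (T, b) is unique: a common
   eigenvector of the commuting operators f |-> Y_t^-1 f(X_t _), acting on the
   degree-preserving linear maps D -> D', is an isomorphism up to a scalar.

   An isomorphism psi of graded matrix algebras M_k(D) -> M_k'(D') sends the
   matrix unit E_11 to a primitive idempotent of degree 0, which is equivalent
   to E_11 of the target through homogeneous elements w, w' of opposite degrees.
   Then d |-> w' psi(d E_11) w is a graded embedding D -> D', so T and b are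
   invariants, and X |-> psi(X) w maps the first column of M_k(D) onto that of
   M_k'(D'), up to a shift of degree. The dimension of the component of degree x
   of such a column is the multiplicity of a coset of T, whence Xi(gamma) up to
   translation. The parameters t_0, Tbar, beta and u mod t_0 are read off (T, b):
   t_0 generates the radical of the restriction of b to the even part of T.

   Conversely, given an odd grading, the module U has a basis over D consisting
   of homogeneous elements of even degree, so M(n,n) = End_D(U) is M_k(D) with
   the required grading; b is nondegenerate because the centre of M_2n(F) is F.
   The element t_0 represents the parity character of T, and an odd element t_1
   of T can be translated by T^+ so that b(t_1, _) is the prescribed character
   chi, because every character of a finite group is represented by a
   nondegenerate bicharacter (linear independence of characters). *)
Require Import Defs.
From HB Require Import structures.
From mathcomp Require Import all_boot all_order all_algebra all_field.
From mathcomp Require Import fingroup perm generic_quotient ring_quotient.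
From mathcomp Require Import finmap boolp ring zify.

Set Implicit Arguments.
Unset Strict Implicit.
Unset Printing Implicit Defensive.

Import GRing.Theory.
Local Open Scope ring_scope.

(** * Homogeneous projections *)

Section Decomposition.
Variables (F : fieldType) (K : zmodType) (V : vectType F).
Variable Vg : K -> {vspace V}.

(** [K] may be infinite, so a finite set [s] carries the sum, while [p g] is defined in every degree
    and vanishes outside [s]. *)
Definition homogeneous_projections (s : {fset K}) (p : K -> 'End(V)) : Prop :=
  [/\ forall v, v = \sum_(g <- s) p g v,
      forall g v, p g v \in Vg g
    & forall g h v, v \in Vg h -> p g v = if g == h then v else 0].

Lemma sumv_seq_subset (s s' : {fset K}) :
  {subset s <= s'} -> (\sum_(g <- s) Vg g <= \sum_(g <- s') Vg g)%VS.
Proof.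
move=> ss'; rewrite [X in (X <= _)%VS]big_seq.
apply: (big_ind (fun U => (U <= _)%VS)); first exact: sub0v.
  by move=> U U' HU HU'; rewrite subv_add HU.
by move=> g /ss' gs'; rewrite (big_fsetD1 g gs') /= addvSl.
Qed.

(** A basis of [V] involves finitely many degrees, collected in [s]; [p g] projects onto [Vg g]
    along the sum of the other components in [s]. *)
Lemma decomposition_projections :
  is_decomposition Vg -> exists s p, homogeneous_projections s p.
Proof.
case=> Vsum Vdir.
have [s fullE] : exists s : {fset K}, (\sum_(g <- s) Vg g)%VS = fullv.
  have [f fP] := choice Vsum.
  exists (\bigcup_(v <- vbasis (fullv : {vspace V})) f v)%fset.
  apply/eqP; rewrite eqEsubv subvf /=.
  rewrite -{1}(span_basis (vbasisP (fullv : {vspace V}))).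
  apply/span_subvP => v vb; apply: subvP (fP v).
  by apply: sumv_seq_subset => g gf; apply/bigfcupP; exists v; rewrite ?vb.
pose rest g := (\sum_(h <- (s `\ g)%fset) Vg h)%VS.
have capE g : (Vg g :&: rest g = 0)%VS.
  have gs : g \notin (s `\ g)%fset by rewrite in_fsetD1 eqxx.
  apply/eqP; rewrite -dimv_eq0 -(eqn_add2l (\dim (Vg g + rest g))) addn0.
  rewrite dimv_sum_cap; apply/eqP; move/directvP: (Vdir (s `\ g)%fset) => /= ->.
  by move/directvP: (Vdir (g |` (s `\ g))%fset); rewrite /= !big_fsetU1.
have addE g : (Vg g + rest g = fullv)%VS.
  apply/eqP; rewrite eqEsubv subvf /= -fullE.
  have -> : (Vg g + rest g = \sum_(h <- (g |` (s `\ g))%fset) Vg h)%VS.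
    by rewrite big_fsetU1 ?in_fsetD1 ?eqxx.
  by apply: sumv_seq_subset => h hs; rewrite in_fset1U in_fsetD1 hs andbT orbN.
have restP g h v : v \in Vg h -> g != h -> v \in rest g.
  move=> vh gh; have [hs|hs] := boolP (h \in s).
    apply: subvP vh; rewrite /rest (big_fsetD1 h) /= ?addvSl //.
    by rewrite in_fsetD1 eq_sym gh.
  (* For [h] outside [s], [rest h] is the whole space and meets [Vg h] trivially, so [v] is 0. *)
  have: v \in (Vg h :&: rest h)%VS.
    rewrite memv_cap vh /rest.
    have -> : (s `\ h)%fset = s.
      by apply/fsetP=> x; rewrite in_fsetD1; case: eqP => // ->; rewrite (negPf hs).
    by rewrite fullE memvf.
  by rewrite capE memv0 => /eqP->; rewrite mem0v.
exists s, (fun g => daddv_pi (Vg g) (rest g)).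
have piE g h v : v \in Vg h ->
    daddv_pi (Vg g) (rest g) v = if g == h then v else 0.
  move=> vh; case: eqP => [gh | /eqP gh].
    by apply: daddv_pi_id (capE g) _; rewrite gh.
  have vr := restP _ _ _ vh gh.
  have := daddv_pi_add (capE g) (memv_add (mem0v _) vr); rewrite add0r.
  rewrite [X in _ + X]daddv_pi_id ?[(rest g :&: _)%VS]capvC //.
  by move=> e; apply: (addIr v); rewrite add0r.
split=> // [v|g v]; last exact: memv_pi.
(* The equation to be proved cuts out a subspace, so it is enough that this subspace contains [Vg h]
   for each [h] in [s]. *)
pose W := lker (\sum_(g <- s) daddv_pi (Vg g) (rest g) - \1)%VF.
suff : v \in W.
  rewrite memv_ker !lfunE /= sum_lfunE !lfunE /= => /eqP/subr0_eq e.
  by rewrite e id_lfunE.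
apply: (subvP _ _ (memvf v)); rewrite -fullE big_seq.
apply: (big_ind (fun U => (U <= W)%VS)); first exact: sub0v.
  by move=> U U' HU HU'; rewrite subv_add HU.
move=> h hs; apply/subvP=> w wh; rewrite memv_ker !lfunE /= sum_lfunE !lfunE /= id_lfunE.
rewrite (big_fsetD1 h hs) /= (piE _ h) // eqxx big_seq big1 ?addr0 ?subrr // => g.
by rewrite in_fsetD1 => /andP[gh _]; rewrite (piE _ h) // (negPf gh).
Qed.

Variables (s : {fset K}) (p : K -> 'End(V)).
Hypothesis Hp : homogeneous_projections s p.

Lemma proj_sum v : v = \sum_(g <- s) p g v. Proof. by case: Hp. Qed.
Lemma proj_mem g v : p g v \in Vg g. Proof. by case: Hp. Qed.
Lemma proj_homog g h v : v \in Vg h -> p g v = if g == h then v else 0.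
Proof. by case: Hp => _ _; apply. Qed.
Lemma proj_id g v : v \in Vg g -> p g v = v.
Proof. by move/(proj_homog g)->; rewrite eqxx. Qed.

Lemma homog_eq0 g h v : v \in Vg g -> v \in Vg h -> g != h -> v = 0.
Proof. by move=> vg vh gh; rewrite -(proj_id vg) (proj_homog g vh) (negPf gh). Qed.

Lemma proj_eq0 v : (forall g, p g v = 0) -> v = 0.
Proof. by move=> v0; rewrite [v]proj_sum big1. Qed.

Lemma homog_supp_mem g : Vg g != 0%VS -> g \in s.
Proof.
apply: contraR => gs; apply/eqP/eqP; rewrite -subv0; apply/subvP=> v vg.
rewrite memv0 [v]proj_sum big_seq big1 // => h hs.
by rewrite (proj_homog h vg); case: eqP hs => // ->; rewrite (negPf gs).
Qed.

Lemma linear_homog_ext (W : vectType F) (f f' : 'Hom(V, W)) :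
  (forall g v, v \in Vg g -> f v = f' v) -> f = f'.
Proof.
move=> ff'; apply/lfunP=> v; rewrite [v]proj_sum !linear_sum.
by apply: eq_bigr => g _; apply: ff' (proj_mem g v).
Qed.

End Decomposition.

(** Both sides are linear in [v], which may then be taken homogeneous. Comparing components in this
    way is what later makes 1, inverses and coordinates homogeneous. *)
Lemma proj_shift (F : fieldType) (K : zmodType) (V W : vectType F)
    (Vg : K -> {vspace V}) (Wg : K -> {vspace W}) s p t q (L : 'Hom(V, W)) h :
    homogeneous_projections Vg s p -> homogeneous_projections Wg t q ->
    (forall g v, v \in Vg g -> L v \in Wg (g + h)) ->
  forall g v, q (g + h) (L v) = L (p g v).
Proof.
move=> Hp Hq HL g v; suff /lfunP/(_ v) : (q (g + h) \o L)%VF = (L \o p g)%VF.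
  by rewrite !comp_lfunE.
apply: (linear_homog_ext Hp) => g' {}v vg'; rewrite !comp_lfunE.
rewrite (proj_homog Hq (g + h) (HL _ _ vg')) (proj_homog Hp g vg').
by rewrite (inj_eq (addIr h)); case: eqP => // _; rewrite linear0.
Qed.

(** * Common eigenvectors and characters *)

Lemma linear_lfunE (F : fieldType) (V W : vectType F) (f : V -> W) :
  linear f -> forall x, linfun f x = f x.
Proof.
move=> fL; pose h : {linear V -> W} := HB.pack f (GRing.isLinear.Build _ _ _ _ f fL).
exact: (lfunE h).
Qed.

Lemma linear_hom (F : fieldType) (V W : vectType F) (f : V -> W) :
  linear f -> exists g : 'Hom(V, W), forall x, g x = f x.
Proof. by move=> fL; exists (linfun f); apply: linear_lfunE. Qed.

Section VspaceOfPred.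
Variables (F : fieldType) (V : vectType F).

(** A subspace inside [P] of maximal dimension contains every [x] satisfying [P], since adding the
    line of [x] stays inside [P]. *)
Lemma vspace_of_pred (P : V -> Prop) :
    P 0 -> (forall c x y, P x -> P y -> P (c *: x + y)) ->
  exists W : {vspace V}, forall x, x \in W <-> P x.
Proof.
move=> P0 PL.
pose Q d := `[< exists W : {vspace V}, \dim W = d /\ forall x, x \in W -> P x >].
have Q0 : exists d, Q d.
  exists 0%N; apply/asboolP; exists 0%VS; rewrite dimv0; split=> // x.
  by rewrite memv0 => /eqP->.
have Qb d : Q d -> (d <= \dim {:V})%N.
  by move=> /asboolP[W [<- _]]; rewrite dimvS ?subvf.
case: (ex_maxnP Q0 Qb) => d /asboolP[W [dW PW]] dmax.
exists W => x; split=> [/PW //|Px].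
have: Q (\dim (<[x]> + W)).
  apply/asboolP; exists (<[x]> + W)%VS; split=> // y.
  by move=> /memv_addP[_ /vlineP[c ->] [w wW ->]]; apply: PL (PW _ wW).
move=> /dmax; rewrite -dW => le_dim.
have /eqP -> : W == (<[x]> + W)%VS by rewrite eqEdim addvSr.
exact: subvP (addvSl _ _) _ (memv_line x).
Qed.

End VspaceOfPred.

Section ClosedField.
Variables (F : closedFieldType) (V : vectType F).

Lemma eigenvector_in (L : 'End(V)) (W : {vspace V}) :
    W != 0%VS -> (forall v, v \in W -> L v \in W) ->
  exists c v, [/\ v \in W, v != 0 & L v = c *: v].
Proof.
move=> W0 LW; pose b := vbasis W; have bW := vbasisP W.
pose A := \matrix_(i < \dim W, j < \dim W) coord b j (L b`_i).
have [c] : exists c, root (char_poly A) c.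
  by apply/closed_rootP; rewrite size_char_poly eqSS dimv_eq0.
rewrite -eigenvalue_root_char => /eigenvalueP[r rA r0].
have LE (i : 'I_(\dim W)) : L b`_i = \sum_j A i j *: b`_j.
  rewrite {1}(coord_basis bW (LW _ (basis_mem bW (mem_nth _ _)))) ?size_tuple //.
  by apply: eq_bigr => j _; rewrite mxE.
exists c, (\sum_i r 0 i *: b`_i); split.
- by apply: memv_suml => i _; rewrite memvZ // (basis_mem bW) ?mem_nth ?size_tuple.
- apply: contra r0 => /eqP r0; apply/eqP/rowP=> i; rewrite mxE.
  by move/freeP: (basis_free bW) => /(_ _ r0).
- rewrite linear_sum scaler_sumr.
  under eq_bigr do rewrite linearZ /= LE scaler_sumr.
  rewrite exchange_big; apply: eq_bigr => j _ /=.
  under eq_bigr do rewrite scalerA.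
  rewrite -scaler_suml scalerA; congr (_ *: _).
  by move/rowP/(_ j): rA; rewrite !mxE.
Qed.

(** A nonzero invariant subspace [U] of least dimension consists of common eigenvectors: an
    eigenspace of [L i] in [U] is invariant under the commuting family, hence equal to [U]. The
    family may be infinite. *)
Lemma common_eigenvector_in (I : Type) (L : I -> 'End(V)) (W : {vspace V}) :
    W != 0%VS -> (forall i v, v \in W -> L i v \in W) ->
    (forall i j v, v \in W -> L i (L j v) = L j (L i v)) ->
  exists2 v, v \in W /\ v != 0 & forall i, exists c, L i v = c *: v.
Proof.
move=> W0 LW LC.
pose Q d := `[< exists U : {vspace V}, [/\ \dim U = d, U != 0%VS, (U <= W)%VS
                   & forall i v, v \in U -> L i v \in U] >].
have: exists d, Q d by exists (\dim W); apply/asboolP; exists W.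
case/ex_minnP => d /asboolP[U [dU U0 UW LU]] dmin.
exists (vpick U).
  by split; rewrite ?vpick0 // (subvP UW) // memv_pick.
move=> i; have [c [v [vU v0 Lv]]] := eigenvector_in U0 (LU i).
pose E := (U :&: lker (L i - c *: \1)%VF)%VS.
have EP x : (x \in E) = (x \in U) && (L i x == c *: x).
  by rewrite memv_cap memv_ker add_lfunE opp_lfunE scale_lfunE id_lfunE subr_eq0.
have QE : Q (\dim E).
  apply/asboolP; exists E; split=> //.
  - apply/eqP=> E0; move/negP: v0; apply.
    by rewrite -memv0 -E0 EP vU Lv eqxx.
  - exact: subv_trans (capvSl _ _) UW.
  - move=> j x; rewrite !EP => /andP[xU /eqP Lx]; rewrite LU // LC.
      by rewrite Lx linearZ eqxx.
    exact: subvP UW _ xU.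
have UE : U = E.
  by apply/esym/eqP; rewrite eqEdim capvSl dU dmin.
by have := memv_pick U; rewrite {2}UE EP => /andP[_ /eqP]; exists c.
Qed.

End ClosedField.

(** * Independence of characters and nondegenerate bicharacters *)

Section Characters.
Variables (F : fieldType) (K : zmodType).

(** Artin's elimination: a relation is compared with its translate by [h], which yields a shorter
    relation. *)
Lemma characters_free (T : {pred K}) (I : eqType) (c : I -> K -> F) :
    {in T &, forall x y, x + y \in T} -> 0 \in T ->
    (forall i, is_character T (c i)) ->
    (forall i j, {in T, c i =1 c j} -> i = j) ->
  forall (r : seq I) (a : I -> F), uniq r ->
    {in T, forall t, \sum_(i <- r) a i * c i t = 0} -> {in r, forall i, a i = 0}.
Proof.
move=> TD T0 cP c_inj; elim=> [//|j r IH] a /= /andP[jr ur] a0.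
have ar : {in r, forall i, a i = 0}.
  move=> i ir; apply: contrapT => /eqP ai.
  suff ij: i = j by rewrite -ij ir in jr.
  apply: c_inj => h hT; apply/eqP; rewrite -subr_eq0.
  (* These coefficients come from subtracting [c j h] times the relation at [t] from the relation at
     [h + t], which removes the term of [j]. *)
  have := IH (fun l => a l * (c l h - c j h)) ur.
  move=> /(_ _ i ir)/eqP; rewrite mulf_eq0 (negPf ai); apply.
  move=> t tT; have [_ cD] := cP j.
  have := congr1 (fun z => z - c j h * \sum_(l <- j :: r) a l * c l t)
    (a0 _ (TD _ _ hT tT)).
  rewrite {2}(a0 _ tT) mulr0 subr0 !big_cons mulrDr cD // mulrCA => e.
  rewrite -[RHS]e opprD addrACA subrr add0r mulr_sumr -sumrB.
  by apply: eq_bigr => l _; have [_ clD] := cP l; rewrite clD //; ring.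
move=> i; rewrite inE => /orP[/eqP->|/ar//].
have := a0 0 T0; rewrite big_cons big_seq big1 => [|l /ar->]; last by rewrite mul0r.
have [/(_ 0 T0) cj0 _] := cP j.
by rewrite addr0 => /eqP; rewrite mulf_eq0 (negPf cj0) orbF => /eqP.
Qed.

Lemma character0 (T : {pred K}) (c : K -> F) :
  0 \in T -> is_character T c -> c 0 = 1.
Proof.
move=> T0 [c0 cD]; apply: (mulfI (c0 0 T0)).
by rewrite -cD // addr0 mulr1.
Qed.

Lemma characterN (T : {pred K}) (c : K -> F) :
  zmod_closed T -> is_character T c -> {in T, forall x, c (- x) = (c x)^-1}.
Proof.
move=> TZ cP x xT; have [T0 TB] := TZ.
have NxT : - x \in T by rewrite -sub0r TB.
have [c0 cD] := cP; apply: (mulfI (c0 x xT)).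
by rewrite -cD // subrr (character0 T0 cP) divff ?c0.
Qed.

(** Both mixed values appear when [b (x + y) (x + y) = 1] is expanded. *)
Lemma alt_bicharV (T : {pred K}) (b : K -> K -> F) :
  zmod_closed T -> is_nondeg_alt_bichar T b ->
  {in T &, forall x y, b y x = (b x y)^-1}.
Proof.
move=> [T0 TB] [bl br balt _] x y xT yT.
have xyT : x + y \in T by rewrite -[y]opprK -(sub0r y) TB ?TB.
have [[bx0 bxD] [by0 byD]] := (bl _ xT, bl _ yT).
have [_ bxyD] := bl _ xyT; have [_ bDx] := br _ xT; have [_ bDy] := br _ yT.
have := balt _ xyT; rewrite bxyD // bDx // bDy // !balt // mul1r mulr1.
by move=> e; apply: (mulIf (bx0 y yT)); rewrite e mulVf ?bx0.
Qed.

Lemma nondeg_alt_bichar_congr (T T' : {pred K}) (b : K -> K -> F) :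
  T =i T' -> is_nondeg_alt_bichar T b -> is_nondeg_alt_bichar T' b.
Proof.
move=> TT' [bl br balt bn]; split=> [x|x|x|x]; rewrite -!TT'.
- by move=> /bl[c0 cD]; split=> [y|y z]; rewrite -!TT'; [apply: c0 | apply: cD].
- by move=> /br[c0 cD]; split=> [y|y z]; rewrite -!TT'; [apply: c0 | apply: cD].
- exact: balt.
- by move=> xT xb; apply: bn => // y yT; apply: xb; rewrite -TT'.
Qed.

(* The characters [b s], [s \in T], together with a further one would be
   [#|T| + 1] linearly independent functions on [T]. *)
Lemma nondeg_bichar_character (S : {fset K}) (b : K -> K -> F) (c : K -> F) :
    zmod_closed [pred x in S] -> is_nondeg_alt_bichar [pred x in S] b ->
    is_character [pred x in S] c ->
  exists2 s, s \in S & {in S, forall t, c t = b s t}.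
Proof.
move=> SZ [bl br _ bn] cP; have [S0 SB] := SZ.
have SD : {in S &, forall x y, x + y \in S}.
  move=> x y xS yS; rewrite -[y]opprK; apply: (SB) => //.
  by rewrite -sub0r; apply: (SB).
apply: contrapT => nc.
pose d (o : option S) := if o is Some s then b (val s) else c.
have dP o : is_character [pred x in S] (d o).
  by case: o => [s|] //=; apply: bl; apply: valP.
have d_inj o o' : {in [pred x in S], d o =1 d o'} -> o = o'.
  case: o o' => [s|] [s'|] //= ss'.
  - congr Some; apply/val_inj/eqP; rewrite -subr_eq0; apply/eqP.
    apply: bn => [|y yS]; first by apply: (SB); apply: valP.
    have [b0 bD] := br _ yS; have [_ SB'] := SZ.
    have -> : b (fsval s - fsval s') y = b (fsval s) y * b (- fsval s') y.
      rewrite bD ?inE ?valP // -sub0r; apply: (SB) => //; exact: valP.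
    rewrite (characterN SZ (br _ yS)) ?inE ?valP //.
    by rewrite ss' // divff // b0 ?inE ?valP.
  - by case: nc; exists (val s); [apply: valP | move=> t /ss'].
  - by case: nc; exists (val s'); [apply: valP | move=> t /ss'].
(* With one more row than columns, [A] has a nonzero vector in its left kernel, which is a linear
   relation between the characters [d o]. *)
pose A := \matrix_(i < #|{: option S}|, j < #|{: S}|) d (enum_val i) (val (enum_val j)).
have /rowV0Pn[v vA v0] : kermx A != 0.
  rewrite kermx_eq0 /row_free neq_ltn (leq_ltn_trans (rank_leq_col A)) //.
  by rewrite card_option.
case/negP: v0; apply/eqP/rowP=> i; rewrite mxE.
have := @characters_free [pred x in S] _ d SD S0 dP d_inj (enum {: option S})
   (fun o => v 0 (enum_rank o)) (enum_uniq _).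
move=> /(_ _ (enum_val i)); rewrite enum_valK; apply; last by rewrite mem_enum.
move=> t tS; move/sub_kermxP/rowP/(_ (enum_rank [` tS]%fset)): vA.
rewrite !mxE => e; rewrite -[RHS]e big_enum /= (reindex_onto enum_rank enum_val) /=.
  apply: eq_big => [o|o _]; first by rewrite enum_rankK eqxx.
  by rewrite mxE !enum_rankK.
by move=> j _; rewrite enum_valK.
Qed.

End Characters.

(** * Graded division algebras *)

Section GradedDivision.
Variables (F : closedFieldType) (K : zmodType) (D : falgType F).
Variable Dg : K -> {vspace D}.
Hypothesis HD : graded_division Dg.

Lemma graded_division_projections : exists s p, homogeneous_projections Dg s p.
Proof. by case: HD => -[/decomposition_projections]. Qed.

Lemma homogM g h x y : x \in Dg g -> y \in Dg h -> x * y \in Dg (g + h).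
Proof. by case: HD => -[_ DM] _; apply: DM. Qed.

Lemma homog_unit g x : x \in Dg g -> x != 0 -> x \is a GRing.unit.
Proof. by case: HD => _ DU; apply: DU. Qed.

Lemma proj_mull s p (Hp : homogeneous_projections Dg s p) g x h y :
  x \in Dg g -> p (h + g) (x * y) = x * p h y.
Proof.
move=> xg; have xE z : amull x z = x * z by rewrite lfunE.
rewrite -!xE; apply: (proj_shift Hp Hp) => h' z zh'.
by rewrite xE addrC; apply: homogM.
Qed.

(** The degree 0 component of 1 is a right identity on homogeneous elements, hence on all of [D], so
    it equals 1. *)
Lemma homog1 : 1 \in Dg 0.
Proof.
have [s [p Hp]] := graded_division_projections.
suff /lfunP/(_ 1) : amulr (p 0 1) = \1%VF.
  by rewrite !lfunE /= mul1r => <-; apply: proj_mem Hp 0 1.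
apply: (linear_homog_ext Hp) => g x xg; rewrite !lfunE /=.
by rewrite -(proj_mull Hp 0 1 xg) add0r mulr1 (proj_id Hp).
Qed.

(** The component of [x^-1] of degree [- g] is already a right inverse of [x]. *)
Lemma homogV g x : x \in Dg g -> x^-1 \in Dg (- g).
Proof.
have [->|x0 xg] := eqVneq x 0; first by rewrite invr0 !mem0v.
have [s [p Hp]] := graded_division_projections.
have xU := homog_unit xg x0.
have : x * p (- g) x^-1 = 1.
  by rewrite -(proj_mull Hp _ _ xg) addNr divrr // (proj_id Hp homog1).
by move/(canRL (mulKr xU)); rewrite mulr1 => <-; apply: proj_mem Hp _ _.
Qed.

Lemma homogM_eq0 g h x y :
  x \in Dg g -> y \in Dg h -> (x * y == 0) = (x == 0) || (y == 0).
Proof.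
move=> xg yh; have [->|x0] := eqVneq x 0; first by rewrite mul0r !eqxx.
by rewrite /= -[X in _ == X](mulr0 x) (inj_eq (mulrI (homog_unit xg x0))).
Qed.

(** If [c] is an eigenvalue of left multiplication by [x], then [x - c%:A] has degree 0 and is not
    invertible, hence is 0. *)
Lemma homog0_scalar x : x \in Dg 0 -> exists c, x = c%:A.
Proof.
move=> x0; have [//||c [y [_ y0]]] := @eigenvector_in _ _ (amull x) fullv.
- by rewrite -dimv_eq0 -lt0n adim_gt0.
- by move=> v _; rewrite memvf.
rewrite lfunE /= => xy; exists c; apply/subr0_eq/eqP; apply: contraT => xc.
have xcU : x - c%:A \is a GRing.unit.
  exact: homog_unit (memvB x0 (memvZ c homog1)) xc.
by rewrite -(mulKr xcU y) mulrBl xy -scalerAl mul1r subrr mulr0 eqxx in y0.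
Qed.

Lemma homog_line g x y :
  x \in Dg g -> x != 0 -> y \in Dg g -> exists c, y = c *: x.
Proof.
move=> xg x0 yg; have [c xy] : exists c, y * x^-1 = c%:A.
  by apply: homog0_scalar; rewrite -(subrr g); apply: homogM yg (homogV xg).
exists c; rewrite -[y](divrK (homog_unit xg x0)) xy.
by rewrite -scalerAl mul1r.
Qed.

Lemma dim_homog g : Dg g != 0%VS -> \dim (Dg g) = 1%N.
Proof.
rewrite -vpick0 => x0; have <- : \dim <[vpick (Dg g)]> = 1%N by rewrite dim_vline x0.
apply/eqP; rewrite eqn_leq !dimvS // -?memvE ?memv_pick //.
apply/subvP=> y yg; have [c ->] := homog_line (memv_pick _) x0 yg.
by rewrite memvZ // memv_line.
Qed.

Lemma supp_zmod_closed : zmod_closed [pred t | Dg t != 0%VS].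
Proof.
split=> [|s t]; rewrite !inE.
  apply: contraNneq (oner_neq0 D) => D0.
  by have := homog1; rewrite D0 memv0.
rewrite -(vpick0 (Dg s)) -(vpick0 (Dg t)) => s0 t0.
have := homogM (memv_pick (Dg s)) (homogV (memv_pick (Dg t))).
apply: contraTneq => ->; rewrite memv0.
rewrite (homogM_eq0 (memv_pick _) (homogV (memv_pick _))).
by rewrite invr_eq0 negb_or s0.
Qed.

Lemma homog_neq0 g x : x \in Dg g -> x != 0 -> Dg g != 0%VS.
Proof. by move=> xg; apply: contraNneq => D0; rewrite D0 memv0 in xg. Qed.

End GradedDivision.

(** * Uniqueness of the graded division algebra with a given support and bicharacter *)

Section Uniqueness.
Variables (F : closedFieldType) (K : zmodType) (T : {pred K}) (b : K -> K -> F).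
Variables (D D' : falgType F) (Dg : K -> {vspace D}) (Dg' : K -> {vspace D'}).
Hypotheses (HD : is_associated T b Dg) (HD' : is_associated T b Dg').

Let GD : graded_division Dg. Proof. by case: HD. Qed.
Let GD' : graded_division Dg'. Proof. by case: HD'. Qed.

(* A common eigenvector of the commuting operators
   [f |-> Y_t^-1 f(X_t _)] on the degree-preserving linear maps from [D] to
   [D'] is, up to a scalar, multiplicative. *)
Lemma associated_iso : exists f : 'Hom(D, D'),
  [/\ forall x y, f (x * y) = f x * f y, lker f == 0%VS, limg f = fullv
    & forall t, (f @: Dg t)%VS = Dg' t].
Proof.
have [s [p Hp]] := graded_division_projections GD.
have [s' [p' Hp']] := graded_division_projections GD'.
pose X t := vpick (Dg t); pose Y t := vpick (Dg' t).
have Xt t : X t \in Dg t by apply: memv_pick.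
have Yt t : Y t \in Dg' t by apply: memv_pick.
have X0 t : (X t == 0) = (t \notin T).
  by rewrite vpick0; case: HD => _ _ -> _ _; rewrite negbK.
have Y0 t : (Y t == 0) = (t \notin T).
  by rewrite vpick0; case: HD' => _ _ -> _ _; rewrite negbK.
have YU t : t \in T -> Y t \is a GRing.unit.
  by move=> tT; apply: homog_unit GD' _ _ (Yt t) _; rewrite Y0 negbK.
have [W WP] : exists W : {vspace 'Hom(D, D')}, forall f, f \in W <->
    (forall t x, x \in Dg t -> f x \in Dg' t).
  apply: vspace_of_pred => [t x _|c f g fP gP t x xt]; first by rewrite lfunE mem0v.
  by rewrite !lfunE /= lfunE /= memvD ?memvZ ?fP ?gP.
have W0 : W != 0%VS.
  (* A nonzero member of [W]: it sends the degree 0 component of [x], a multiple of 1, to the same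
     multiple of 1, and kills the other components. *)
  pose e1 := [tuple (1 : D)].
  have [f fE] : exists f : 'Hom(D, D'), forall x, f x = coord e1 ord0 (p 0 x) *: 1.
    apply: linear_hom => c x y.
    by rewrite !linearP /= scalerDl scalerA.
  have fW : f \in W.
    apply/WP => t x xt; rewrite fE (proj_homog Hp 0 xt).
    case: eqP => [<-|_]; first by rewrite memvZ // (homog1 GD').
    by rewrite linear0 scale0r mem0v.
  apply: contraTneq fW => ->; rewrite memv0; apply/eqP => /lfunP/(_ 1).
  rewrite fE (proj_id Hp (homog1 GD)) !lfunE /=.
  rewrite -[X in coord _ _ X]/(e1`_(@ord0 0)) coord_free ?seq1_free ?oner_neq0 //.
  by rewrite eqxx scale1r => /eqP; rewrite oner_eq0.
have [L LE] : exists L : K -> 'End('Hom(D, D')), forall t f x,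
    L t f x = (Y t)^-1 * f (X t * x).
  suff /choice[L LP] : forall t, exists Lt : 'End('Hom(D, D')), forall f,
      Lt f = (amull (Y t)^-1%R \o f \o amull (X t))%VF.
    by exists L => t f x; rewrite LP !comp_lfunE !lfunE.
  move=> t; apply: linear_hom => c f g; apply/lfunP=> x.
  by rewrite add_lfunE scale_lfunE !comp_lfunE add_lfunE scale_lfunE linearP.
have LW t f : f \in W -> L t f \in W.
  move=> /WP fP; apply/WP => h x xh; rewrite LE -[h](addKr t).
  by apply: (homogM GD') (homogV GD' (Yt t)) (fP _ _ (homogM GD (Xt t) xh)).
have LC t u f : f \in W -> L t (L u f) = L u (L t f).
  move=> _; apply/lfunP=> x; rewrite !LE !mulrA.
  (* Outside [T] the vectors [X t] and [Y t] are 0. Inside [T], exchanging the two [X] produces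
     [b t u] and exchanging the inverses of the two [Y] produces its inverse, so the factors
     cancel. *)
  have [tT|/negPf tT] := boolP (t \in T); last first.
    move: (X0 t) (Y0 t); rewrite tT => /eqP-> /eqP->.
    by rewrite !(invr0, mul0r, mulr0, linear0).
  have [uT|/negPf uT] := boolP (u \in T); last first.
    move: (X0 u) (Y0 u); rewrite uT => /eqP-> /eqP->.
    by rewrite !(invr0, mul0r, mulr0, linear0).
  case: HD => _ _ _ _ /(_ t u tT uT _ _ (Xt t) (Xt u)) ->.
  case: HD' => _ _ _ _ /(_ t u tT uT _ _ (Yt t) (Yt u)) e.
  rewrite -scalerAl linearZ /= -scalerAr scalerAl; congr (_ * _).
  rewrite -!invrM ?YU // e.
  have b0 : b t u != 0.
    apply: contraTneq isT => b0; move/eqP: e; rewrite b0 scale0r.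
    by rewrite (homogM_eq0 GD' (Yt t) (Yt u)) !Y0 tT uT.
  by rewrite invrZ ?unitfE ?unitrMl ?YU // scalerA divff ?scale1r.
have [f [fW f0] fL] := common_eigenvector_in W0 LW LC.
have [c cP] := choice fL.
have fX t x : t \in T -> f (X t * x) = c t *: Y t * f x.
  move=> tT; have /lfunP/(_ x) := cP t; rewrite LE lfunE /= => e.
  by rewrite -[LHS](mulVKr (YU t tT)) e -scalerAr scalerAl.
have [z f1] : exists z, f 1 = z%:A.
  by apply: homog0_scalar GD' _ _; move/WP: fW; apply; apply: homog1.
(* If [f 1] were 0, the eigenvector equation at 1 would give [f (X t) = 0] for all [t] in [T], hence
   [f = 0]. Dividing by [z] then makes the map unital. *)
have z0 : z != 0.
  apply: contraNneq f0 => z0; apply/eqP; apply: (linear_homog_ext Hp) => t x xt.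
  rewrite lfunE /=; have [->|x0] := eqVneq x 0; first by rewrite linear0.
  have tT : t \in T by case: HD => _ _ -> _ _; apply: homog_neq0 xt x0.
  have Xn0 : X t != 0 by rewrite X0 negbK.
  have [d ->] := homog_line GD (Xt t) Xn0 xt.
  by rewrite linearZ /= -[X t]mulr1 fX // f1 z0 scale0r mulr0 scaler0.
have [g gfE] : exists g : 'Hom(D, D'), forall x, g x = z^-1 *: f x.
  by exists (z^-1 *: f) => x; rewrite lfunE.
have g1 : g 1 = 1 by rewrite gfE f1 scalerA mulVf ?scale1r.
have gW t x : x \in Dg t -> g x \in Dg' t.
  by move=> xt; rewrite gfE memvZ //; move/WP: fW; apply.
have gM x y : g (x * y) = g x * g y.
  suff /lfunP/(_ x) : (g \o amulr y)%VF = (amulr (g y) \o g)%VF.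
    by rewrite !comp_lfunE !lfunE.
  apply: (linear_homog_ext Hp) => t {}x xt; rewrite !comp_lfunE !lfunE /=.
  have [->|x0] := eqVneq x 0; first by rewrite !(mul0r, linear0).
  have tT : t \in T by case: HD => _ _ -> _ _; apply: homog_neq0 xt x0.
  have Xn0 : X t != 0 by rewrite X0 negbK.
  have [d ->] := homog_line GD (Xt t) Xn0 xt.
  rewrite -scalerAl !linearZ /= -!scalerAl; congr (_ *: _).
  have gX w : g (X t * w) = c t *: Y t * g w.
    by rewrite !gfE fX // scalerAr.
  by rewrite gX -[X t in RHS]mulr1 gX g1 mulr1.
(* The homogeneous components of an element of the kernel are in the kernel, and a nonzero one would
   be a unit, contradicting [g 1 = 1]. *)
have gK : lker g == 0%VS.
  rewrite -subv0; apply/subvP=> x; rewrite memv_ker memv0 => /eqP gx.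
  apply/eqP/(proj_eq0 Hp) => t.
  have e : g (p t x) = 0.
    have gW0 h y : y \in Dg h -> g y \in Dg' (h + 0) by rewrite addr0; apply: gW.
    by rewrite -(proj_shift Hp Hp' gW0) gx linear0.
  apply: contrapT => /eqP x0.
  have xU := homog_unit GD (proj_mem Hp t x) x0.
  by have /eqP := g1; rewrite -(divrr xU) gM e mul0r eq_sym oner_eq0.
have gE t : (g @: Dg t)%VS = Dg' t.
  apply/eqP; rewrite eqEdim limg_dim_eq ?(eqP gK) ?capv0 //.
  apply/andP; split.
    by apply/subvP=> _ /memv_imgP[x xt ->]; apply: gW.
  have [tT|tT] := boolP (t \in T).
    case: HD => _ _ _ /(_ t tT) -> _; case: HD' => _ _ _ /(_ t tT) -> _.
    by [].
  suff /eqP -> : Dg' t == 0%VS by rewrite dimv0.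
  by apply: contraNT tT; case: HD' => _ _ ->.
exists g; split=> //; apply/eqP; rewrite eqEsubv subvf /=.
apply/subvP=> y _; rewrite [y](proj_sum Hp') memv_suml // => t _.
have := proj_mem Hp' t y; rewrite -gE; apply: subvP.
by rewrite limgS ?subvf.
Qed.

End Uniqueness.

(** * Graded matrix algebras *)

Section HomogeneousMatrices.
Variables (F : closedFieldType) (K : zmodType) (D : falgType F).
Variable Dg : K -> {vspace D}.
Hypothesis HD : graded_division Dg.

(** Rectangular shapes are allowed so that columns and rows, taken with a single basis vector of
    degree 0 on the other side, are homogeneous matrices too. *)
Definition homog_mx k l (g : 'I_k -> K) (h : 'I_l -> K) (x : K)
    (X : 'M[D]_(k, l)) : Prop :=
  forall i j, X i j \in Dg (- g i + x + h j).

Lemma homog_mulmx k l m (g : 'I_k -> K) (h : 'I_l -> K) (f : 'I_m -> K) x y X Y :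
  homog_mx g h x X -> homog_mx h f y Y -> homog_mx g f (x + y) (X *m Y).
Proof.
move=> HX HY i j; rewrite mxE memv_suml // => a _.
have -> : - g i + (x + y) + f j = (- g i + x + h a) + (- h a + y + f j).
  by rewrite -!addrA (addrA (h a)) subrr add0r.
exact (homogM HD (HX i a) (HY a j)).
Qed.

Lemma homog_delta_mx k l (g : 'I_k -> K) (h : 'I_l -> K) i j t d :
  d \in Dg t -> homog_mx g h (g i + t - h j) (d *: delta_mx i j).
Proof.
move=> dt a b; rewrite !mxE.
have [->|_] := eqVneq a i; last by rewrite mulr0 mem0v.
have [->|_] := eqVneq b j; last by rewrite mulr0 mem0v.
by rewrite mulr1 -!addrA addNr addr0 addKr.
Qed.

Lemma map_mx_scale k l c (X : 'M[D]_(k, l)) : map_mx ( *:%R c) X = c%:A *: X.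
Proof. by apply/matrixP=> i j; rewrite !mxE -scalerAl mul1r. Qed.

End HomogeneousMatrices.

(** * Counting dimensions of spaces of homogeneous columns *)

Section ColumnCount.
Variables (F : closedFieldType) (K : zmodType) (D D' : falgType F).
Variables (Dg : K -> {vspace D}) (Dg' : K -> {vspace D'}).
Hypothesis HD' : graded_division Dg'.
Variables (k k' : nat) (g : 'I_k -> K) (g' : 'I_k' -> K).

(** The picks [X i] give independent columns of degree [x], one for each [i] counted on the left,
    while every nonzero component of [D'] is a line. If the left count were larger, a nontrivial
    combination of these columns would be killed by [r]. *)
Lemma homog_column_count (x x' : K) (r : 'cV[D]_k -> 'cV[D']_k') :
    (forall v w, r (v + w) = r v + r w) ->
    (forall c v, r (c%:A *: v) = c%:A *: r v) ->
    (forall v, r v = 0 -> v = 0) ->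
    (forall v, homog_mx Dg g (fun=> 0) x v -> homog_mx Dg' g' (fun=> 0) x' (r v)) ->
  (#|[pred i | Dg (- g i + x) != 0%VS]| <= #|[pred i | Dg' (- g' i + x') != 0%VS]|)%N.
Proof.
move=> rD rZ r_inj rP; set I := [pred i | _]; set J := [pred j | _].
have r0 : r 0 = 0 by apply: (addIr (r 0)); rewrite -rD !add0r.
pose X i := vpick (Dg (- g i + x)); pose Y j := vpick (Dg' (- g' j + x')).
pose v i : 'cV[D]_k := X i *: delta_mx i 0.
have vP i : homog_mx Dg g (fun=> 0) x (v i).
  have := homog_delta_mx g (fun=> 0) i (0 : 'I_1) (memv_pick (Dg (- g i + x))).
  by rewrite addrA subrr add0r subr0.
have /choice[c cP] : forall ij : 'I_k * 'I_k', exists c : F, r (v ij.1) ij.2 0 = c *: Y ij.2.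
  case=> i j /=; have := rP _ (vP i) j 0; rewrite addr0 => rij.
  have [Y0|Y0] := eqVneq (Y j) 0; last exact (homog_line HD' (memv_pick _) Y0 rij).
  exists 0; rewrite scale0r; apply/eqP; rewrite -memv0.
  by move/eqP: Y0; rewrite vpick0 => /eqP <-.
pose C := \matrix_(i < #|I|, j < #|J|) c (enum_val i, enum_val j).
rewrite leqNgt; apply/negP => JI.
have /rowV0Pn[z /sub_kermxP zC z0] : kermx C != 0.
  by rewrite kermx_eq0 /row_free neq_ltn (leq_ltn_trans (rank_leq_col C)).
pose u := \sum_(i < #|I|) (z 0 i)%:A *: v (enum_val i).
have ru : r u = 0.
  have -> : r u = \sum_(i < #|I|) (z 0 i)%:A *: r (v (enum_val i)).
    rewrite /u; elim/big_rec2: _ => [//|i a b _ <-].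
    by rewrite rD rZ.
  apply/matrixP=> j o; rewrite ord1 summxE mxE.
  under eq_bigr do rewrite mxE (cP (_, _)) /= -scalerAl mul1r scalerA.
  rewrite -scaler_suml; have [jJ|jJ] := boolP (j \in J).
    move/rowP/(_ (enum_rank_in jJ j)): zC; rewrite !mxE => zC0.
    rewrite (eq_bigr (fun i => z 0 i * C i (enum_rank_in jJ j))) ?zC0 ?scale0r //.
    by move=> i _; rewrite mxE enum_rankK_in.
  move: jJ; rewrite inE negbK -vpick0 -/(Y j) => /eqP->.
  by rewrite scaler0.
case/negP: z0; apply/eqP/rowP=> i; rewrite mxE.
have /matrixP/(_ (enum_val i) 0) := r_inj _ ru.
rewrite summxE mxE (bigD1 i) //= big1 => [|a ai]; last first.
  rewrite !mxE; case: eqP => [/enum_val_inj ia|_]; first by rewrite ia eqxx in ai.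
  by rewrite !mulr0.
rewrite !mxE !eqxx mulr1 addr0 -scalerAl mul1r => /eqP.
have := enum_valP i; rewrite inE -vpick0 -/(X _) => X0.
by rewrite scaler_eq0 (negPf X0) orbF => /eqP.
Qed.

End ColumnCount.

(** * The corner of a graded matrix algebra under an isomorphism *)

Section CornerEquivalence.
Variables (F : closedFieldType) (K : zmodType) (D D' : falgType F).
Variables (Dg : K -> {vspace D}) (Dg' : K -> {vspace D'}).
Hypotheses (HD : graded_division Dg) (HD' : graded_division Dg').
Variables (k k' : nat) (g : 'I_k.+1 -> K) (g' : 'I_k' -> K).
Variables (psi : 'M[D]_k.+1 -> 'M[D']_k') (psi' : 'M[D']_k' -> 'M[D]_k.+1).
Hypotheses (psiK : cancel psi psi') (psi'K : cancel psi' psi).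
Hypothesis psiD : forall X Y, psi (X + Y) = psi X + psi Y.
Hypothesis psiZ : forall c X, psi (c%:A *: X) = c%:A *: psi X.
Hypothesis psiM : forall X Y, psi (X *m Y) = psi X *m psi Y.
Hypothesis psiP : forall x X, homog_mx Dg g g x X <-> homog_mx Dg' g' g' x (psi X).

Let e : 'M[D]_k.+1 := delta_mx 0 0.

Let psi_inj : injective psi. Proof. exact: can_inj psiK. Qed.

Let psi0 : psi 0 = 0.
Proof. by apply: (addIr (psi 0)); rewrite -psiD !add0r. Qed.

Let eM d d' : (d *: e) *m (d' *: e) = (d * d') *: e.
Proof.
rewrite -scalemxAl -scalerA; congr (_ *: _); apply/matrixP=> i j.
rewrite !mxE (bigD1 0) //= big1 => [|l l0]; last first.
  by rewrite !mxE (negPf l0) andbF mul0r.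
rewrite !mxE eqxx andbT addr0; case: (i == 0); rewrite ?mul1r ?mul0r //=.
by rewrite mulr0.
Qed.

Let eE (X : 'M[D]_k.+1) : e *m X *m e = X 0 0 *: e.
Proof.
apply/matrixP=> i j; rewrite !mxE (bigD1 0) //= big1 => [|l l0]; last first.
  by rewrite !mxE (negPf l0) mulr0.
rewrite !mxE (bigD1 0) //= big1 => [|l l0]; last first.
  by rewrite !mxE (negPf l0) andbF mul0r.
rewrite !mxE !eqxx !addr0 andbT.
by case: (i == 0); case: (j == 0); rewrite /= ?mul1r ?mulr1 ?mulr0 ?mul0r.
Qed.

(* [psi e] is a primitive idempotent of degree 0, hence equivalent, through
   homogeneous elements of opposite degrees, to a diagonal matrix unit. *)
Lemma corner_equivalence :
  exists h (w : 'cV[D']_k') (w' : 'rV[D']_k'),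
    [/\ homog_mx Dg' g' (fun=> 0) h w, homog_mx Dg' (fun=> 0) g' (- h) w',
        w' *m w = 1%:M & w *m w' = psi e].
Proof.
pose P := psi e.
have ee : e *m e = e by rewrite mul_delta_mx.
have PP : P *m P = P by rewrite -psiM ee.
have eP : homog_mx Dg g g 0 e.
  have := homog_delta_mx g g 0 0 (homog1 HD).
  by rewrite scale1r addr0 subrr.
have PD := (psiP _ _).1 eP; rewrite -/P in PD.
have /matrix0Pn[i [j Pij]] : P != 0.
  rewrite -psi0 (inj_eq psi_inj); apply/matrix0Pn; exists 0, 0.
  by rewrite mxE oner_neq0.
have PU := homog_unit HD' (PD i j) Pij.
(* The entry [P i j] is a unit, and the [(i, j)] entry of [P *m P = P] shows that rescaling row [i]
   by its inverse makes [w' *m w] equal to 1. *)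
pose w := col j P; pose w' := (P i j)^-1 *: row i P.
have w'w : w' *m w = 1%:M.
  apply/matrixP=> a b; rewrite !ord1 -scalemxAl mxE.
  have -> : (row i P *m w) 0 0 = (P *m P) i j.
    by rewrite !mxE; apply: eq_bigr => l _; rewrite !mxE.
  by rewrite PP mulVr // mxE.
have Pw : P *m w = w by rewrite /w colE mulmxA PP.
have w'P : w' *m P = w' by rewrite -scalemxAl -row_mul PP.
have wD : homog_mx Dg' g' (fun=> 0) (g' j) w.
  by move=> a b; have := PD a j; rewrite !mxE !addr0.
have w'D : homog_mx Dg' (fun=> 0) g' (- g' j) w'.
  move=> a b; rewrite !mxE oppr0 add0r.
  have := homogM HD' (homogV HD' (PD i j)) (PD i b).
  by rewrite !addr0 opprD opprK addrACA subrr add0r.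
exists (g' j), w, w'; split=> //.
(* The preimage [q] of the idempotent [w *m w'] lies in the corner of [e], so it is [q 0 0 *: e]
   with [q 0 0] an idempotent of degree 0. A nonzero such idempotent is a unit, hence 1. *)
pose q := psi' (w *m w').
have qE : psi q = w *m w' by rewrite /q psi'K.
have qq : q *m q = q.
  by apply: psi_inj; rewrite psiM qE -mulmxA (mulmxA w') w'w mul1mx.
have eqe : e *m q *m e = q.
  by apply: psi_inj; rewrite !psiM qE !mulmxA Pw -mulmxA w'P.
have q00 : q = q 0 0 *: e by rewrite -[LHS]eqe eE.
have qD : q 0 0 \in Dg 0.
  have /psiP/(_ 0 0) : homog_mx Dg' g' g' 0 (psi q).
    by rewrite qE -(subrr (g' j)); exact (homog_mulmx HD' wD w'D).
  by rewrite addr0 addNr.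
have q1 : q 0 0 * q 0 0 = q 0 0.
  have /matrixP/(_ 0 0) := qq; rewrite {1 2}q00 eM !mxE mulr1.
  by move=> ->.
suff q001 : q 0 0 = 1 by rewrite -qE q00 q001 scale1r.
have q0 : q 0 0 != 0.
  apply: contraNneq (oner_neq0 D') => q0.
  have : w' *m (w *m w') *m w = 0.
    by rewrite -qE q00 q0 scale0r psi0 mulmx0 mul0mx.
  by rewrite !mulmxA w'w mul1mx w'w => /matrixP/(_ 0 0); rewrite !mxE => /eqP.
by apply: (mulrI (homog_unit HD qD q0)); rewrite q1 mulr1.
Qed.

Section Consequences.
Variables (h : K) (w : 'cV[D']_k') (w' : 'rV[D']_k').
Hypotheses (wD : homog_mx Dg' g' (fun=> 0) h w).
Hypotheses (w'D : homog_mx Dg' (fun=> 0) g' (- h) w').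
Hypotheses (w'w : w' *m w = 1%:M) (ww' : w *m w' = psi e).

Definition corner_map (d : D) : D' := (w' *m psi (d *: e) *m w) 0 0.

Lemma corner_mapM d d' : corner_map (d * d') = corner_map d * corner_map d'.
Proof.
rewrite /corner_map; set A := _ *m w; set B := _ *m w; set C := _ *m w.
suff -> : A = B *m C by rewrite mxE big_ord1.
rewrite /A /B /C !mulmxA -(mulmxA _ w w') ww' -(mulmxA _ (psi e)) -psiM.
rewrite -(mulmxA w' _ (psi _)) -psiM; congr (_ *m psi _ *m _).
by rewrite -[X in _ *m (X *m _)]scale1r !eM mul1r.
Qed.

Lemma corner_mapZ c d : corner_map (c *: d) = c *: corner_map d.
Proof.
rewrite /corner_map.
have -> : (c *: d) *: e = c%:A *: (d *: e) by rewrite scalerA -scalerAl mul1r.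
rewrite psiZ !mxE scaler_sumr; apply: eq_bigr => j _.
rewrite scalerAl; congr (_ * _); rewrite !mxE scaler_sumr.
by apply: eq_bigr => i _; rewrite mxE -scalerAl mul1r scalerAr.
Qed.

Lemma corner_map_homog t d : d \in Dg t -> corner_map d \in Dg' t.
Proof.
move=> dt; have := homog_delta_mx g g 0 0 dt.
rewrite addrAC subrr add0r => /psiP deD.
have := homog_mulmx HD' (homog_mulmx HD' w'D deD) wD 0 0.
by rewrite oppr0 add0r addr0 addrAC addNr add0r.
Qed.

Lemma corner_map_eq0 d : corner_map d = 0 -> d = 0.
Proof.
move=> d0; have : psi (d *: e) = 0.
  have <- : psi e *m psi (d *: e) *m psi e = psi (d *: e).
    by rewrite -!psiM -[X in X *m _ *m X]scale1r !eM mul1r mulr1.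
  have A0 : w' *m psi (d *: e) *m w = 0.
    by apply/matrixP=> i j; rewrite !ord1 [LHS]d0 mxE.
  by rewrite -ww' !mulmxA -(mulmxA w) -(mulmxA w) A0 mulmx0 mul0mx.
rewrite -psi0 => /psi_inj/matrixP/(_ 0 0).
by rewrite !mxE mulr1.
Qed.

(** The injective map on columns is [psi (v *m r) *m w], with [r] the first unit row. Multiplication
    by [r] contributes the shift [- g ord0], and [w] contributes [h]. *)
Lemma corner_count_le x :
  (#|[pred i | Dg (- g i + x) != 0%VS]| <=
   #|[pred a | Dg' (- g' a + (x - g ord0 + h)) != 0%VS]|)%N.
Proof.
pose r : 'rV[D]_k.+1 := delta_mx 0 0.
have re : r *m e = r by rewrite mul_delta_mx.
have rc : r *m delta_mx 0 0 = 1%:M.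
  by rewrite mul_delta_mx; apply/matrixP=> i j; rewrite !ord1 !mxE.
have rD : homog_mx Dg (fun=> 0) g (- g 0) r.
  have := homog_delta_mx (fun=> 0) g (0 : 'I_1) 0 (homog1 HD).
  by rewrite scale1r !add0r.
apply: (homog_column_count HD' (r := fun v => psi (v *m r) *m w)).
- by move=> v v'; rewrite mulmxDl psiD mulmxDl.
- by move=> c v; rewrite -scalemxAl psiZ -scalemxAl.
- move=> v v0; have : psi (v *m r) = 0.
    by rewrite -re mulmxA psiM -ww' mulmxA v0 mul0mx.
  rewrite -psi0 => /psi_inj vr0.
  by rewrite -[v]mulmx1 -rc mulmxA vr0 mul0mx.
- move=> v vD; apply (homog_mulmx HD') with (2 := wD); apply/psiP.
  exact (homog_mulmx HD vD rD).
Qed.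

(** The same count in the opposite direction, for the map [psi' (v *m w') *m c] with [c] the first
    unit column. *)
Lemma corner_count_ge x :
  (#|[pred a | Dg' (- g' a + x) != 0%VS]| <=
   #|[pred i | Dg (- g i + (x - h + g ord0)) != 0%VS]|)%N.
Proof.
pose c : 'cV[D]_k.+1 := delta_mx 0 0; pose r : 'rV[D]_k.+1 := delta_mx 0 0.
have cr : c *m r = e by rewrite mul_delta_mx.
have cD : homog_mx Dg g (fun=> 0) (g 0) c.
  have := homog_delta_mx g (fun=> 0) 0 (0 : 'I_1) (homog1 HD).
  by rewrite scale1r addr0 subr0.
have psi'D X Y : psi' (X + Y) = psi' X + psi' Y.
  by apply: psi_inj; rewrite psiD !psi'K.
have psi'Z a X : psi' (a%:A *: X) = a%:A *: psi' X.
  by apply: psi_inj; rewrite psiZ !psi'K.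
have psi'0 : psi' 0 = 0 by rewrite -psi0 psiK.
apply: (homog_column_count HD (r := fun v => psi' (v *m w') *m c)).
- by move=> v v'; rewrite mulmxDl psi'D mulmxDl.
- by move=> a v; rewrite -scalemxAl psi'Z -scalemxAl.
- move=> v v0; have : psi' (v *m w') *m e = 0.
    by rewrite -cr mulmxA v0 mul0mx.
  move/(congr1 psi); rewrite psiM psi'K -ww' psi0 mulmxA -(mulmxA v) w'w mulmx1.
  by move=> vw'; rewrite -[v]mulmx1 -w'w mulmxA vw' mul0mx.
- move=> v vD; apply (homog_mulmx HD) with (2 := cD); apply/psiP; rewrite psi'K.
  exact (homog_mulmx HD' vD w'D).
Qed.

End Consequences.
End CornerEquivalence.

(** * Isomorphisms of graded matrix algebras from matching cosets *)

Section GradedMatrixIso.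
Variables (F : closedFieldType) (K : zmodType) (T : {pred K}) (b : K -> K -> F).
Variables (D D' : falgType F) (Dg : K -> {vspace D}) (Dg' : K -> {vspace D'}).
Hypotheses (HD : is_associated T b Dg) (HD' : is_associated T b Dg').
Variables (k : nat) (g g' : 'I_k -> K) (s : 'S_k) (g0 : K).
Hypothesis gs : forall i, - g' i + g0 + g (s i) \in T.

(** The permutation [s] matches cosets, and conjugation by a diagonal matrix of homogeneous units
    [z i] of degree [d i] absorbs the differences inside each coset. The common shift [g0] cancels
    in [d i - d j]. *)
Lemma graded_mx_iso : exists psi : 'M[D]_k -> 'M[D']_k,
  [/\ bijective psi, forall X Y, psi (X + Y) = psi X + psi Y,
      forall c X, psi (map_mx ( *:%R c) X) = map_mx ( *:%R c) (psi X),
      forall X Y, psi (X *m Y) = psi X *m psi Y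
    & forall x X, homog_mx Dg g g x X <-> homog_mx Dg' g' g' x (psi X)].
Proof.
have [f [fM f0 fT fE]] := associated_iso HD HD'.
have GD' : graded_division Dg' by case: HD'.
pose d i := - g' i + g0 + g (s i); pose z i := vpick (Dg' (d i)).
have zD i : z i \in Dg' (d i) by apply: memv_pick.
have zU i : z i \is a GRing.unit.
  apply: (homog_unit GD' (zD i)); rewrite vpick0.
  by case: HD' => _ _ <- _ _; apply: gs.
have fDg x t : x \in Dg t <-> f x \in Dg' t.
  rewrite -fE; split=> [|/memv_imgP[y yt /(lker0P f0)->]] //; exact: memv_img.
pose psi X := \matrix_(i, j) (z i * f (X (s i) (s j)) * (z j)^-1).
pose psi' Y := \matrix_(i, j) (f^-1%VF ((z ((s^-1)%g i))^-1 *
   (Y : 'M[D']_k) ((s^-1)%g i) ((s^-1)%g j) * z ((s^-1)%g j))).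
exists psi; split.
- exists psi' => X; apply/matrixP=> i j.
    by rewrite !mxE !permKV !mulrA mulVr // mul1r divrK // lker0_lfunK.
  by rewrite !mxE !permK limg_lfunVK ?fT ?memvf // !mulrA divrr // mul1r mulrK.
- by move=> X Y; apply/matrixP=> i j; rewrite !mxE linearD mulrDr mulrDl.
- by move=> c X; apply/matrixP=> i j; rewrite !mxE linearZ /= -scalerAr -scalerAl.
- move=> X Y; apply/matrixP=> i j; rewrite !mxE linear_sum mulr_sumr mulr_suml.
  rewrite (reindex_inj (@perm_inj _ s)); apply: eq_bigr => l _.
  by rewrite /= fM !mxE !mulrA divrK.
- move=> x X.
  have dE i j : - g' i + x + g' j = d i + (- g (s i) + x + g (s j)) - d j.
    have cancel1 (A B y t u : K) : (A + t) + (- t + y + u) - (B + u) = A + y - B.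
      by rewrite -!addrA (addrA t) subrr add0r opprD (addrCA u) subrr addr0.
    by rewrite /d cancel1 [in RHS](addrAC (- g' i)) [in RHS](addrC (- g' j)) addrKA opprK.
  split=> HX i j.
    rewrite mxE dE; apply: (homogM GD' (homogM GD' (zD i) _) (homogV GD' (zD j))).
    exact/fDg/HX.
  have := HX ((s^-1)%g i) ((s^-1)%g j); rewrite mxE dE !permKV => HXij.
  apply/fDg; set t := - g i + x + g j in HXij *.
  have := homogM GD' (homogV GD' (zD ((s^-1)%g i))) (homogM GD' HXij (zD ((s^-1)%g j))).
  by rewrite divrK // mulKr // subrK addKr.
Qed.

End GradedMatrixIso.

(** * Parity and gradings of the superalgebra *)

Section SharpIso.
Variables (F : fieldType) (G : zmodType) (n : nat).
Implicit Types A : G -> {vspace 'M[F]_(n + n)}.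

Lemma Z2_cases (i : 'Z_2) : i = 0 \/ i = 1.
Proof. by case: i => -[|[|//]] ?; [left | right]; apply: val_inj. Qed.

Lemma Mnn_part_cap (i : 'Z_2) : (Mnn_part F n i :&: Mnn_part F n (i + 1)%R)%VS = 0%VS.
Proof.
have : (Mnn_part F n 0%R :&: Mnn_part F n 1%R)%VS = 0%VS.
  apply/eqP; rewrite -subv0; apply/subvP=> x; rewrite memv0 /Mnn_part /=.
  rewrite !memv_cap !memv_ker !linear_lfunE;
    try by move=> c y z; apply/matrixP=> a b; rewrite !mxE.
  case/andP=> /andP[/eqP ur /eqP dl] /andP[/eqP ul /eqP dr].
  by rewrite -[x]submxK ur dl ul dr block_mx0.
by case: (Z2_cases i) => ->; rewrite ?add0r // capvC.
Qed.

Lemma super_gradingE A : is_super_grading A ->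
  forall g i, A g = (sharp A (g, i) + sharp A (g, i + 1)%R)%VS.
Proof.
move=> [_ AE] g i; rewrite {1}AE /sharp /=.
by case: (Z2_cases i) => ->; rewrite ?add0r // addvC.
Qed.

Lemma Mnn_part_sharp A i x : is_super_grading A -> x \in Mnn_part F n i ->
  exists (s : {fset G}) (y : G -> 'M[F]_(n + n)),
    x = \sum_(g <- s) y g /\ forall g, y g \in sharp A (g, i).
Proof.
move=> HA xi; have [[Adec _] _] := HA.
have [s [p Hp]] := decomposition_projections Adec.
have /choice[yz yzP] : forall g, exists yz : 'M[F]_(n + n) * 'M[F]_(n + n),
    [/\ yz.1 \in sharp A (g, i), yz.2 \in sharp A (g, i + 1) & p g x = yz.1 + yz.2].
  move=> g; have := proj_mem Hp g x; rewrite (super_gradingE HA g i).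
  by case/memv_addP=> y ys [z zs ->]; exists (y, z).
exists s, (fun g => (yz g).1); split=> [|g]; last by case: (yzP g).
have xE : x = \sum_(g <- s) (yz g).1 + \sum_(g <- s) (yz g).2.
  by rewrite {1}(proj_sum Hp x) -big_split; apply: eq_bigr => g _; case: (yzP g).
suff /eqP z0 : \sum_(g <- s) (yz g).2 == 0 by rewrite {1}xE z0 addr0.
rewrite -memv0 -(Mnn_part_cap i) memv_cap; apply/andP; split.
  have -> : \sum_(g <- s) (yz g).2 = x - \sum_(g <- s) (yz g).1.
    by rewrite [X in X - _]xE addrC addKr.
  rewrite memvB // memv_suml // => g _; case: (yzP g).
  by rewrite /sharp memv_cap => /andP[].
rewrite memv_suml // => g _; case: (yzP g) => _.
by rewrite /sharp memv_cap => /andP[].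
Qed.

(** Matching the sharp components suffices: they span both the parity parts and the components
    [A g]. *)
Lemma sharp_iso A A' (f : 'End('M[F]_(n + n))) :
    is_super_grading A -> is_super_grading A' -> lker f == 0%VS ->
    (forall x y, f (x *m y) = f x *m f y) ->
    (forall x m, m \in sharp A x <-> f m \in sharp A' x) ->
  gradings_isomorphic A A'.
Proof.
move=> HA HA' f0 fM fS; exists f; split=> // [i|g].
  apply/eqP; rewrite eqEdim limg_dim_eq ?(eqP f0) ?capv0 // leqnn andbT.
  apply/subvP=> _ /memv_imgP[x xi ->].
  have [s [y [-> yS]]] := Mnn_part_sharp HA xi.
  rewrite linear_sum memv_suml // => g _; have /fS := yS g.
  by rewrite memv_cap => /andP[].
have fT : limg f = fullv by apply/eqP; rewrite eqEdim subvf limg_dim_eq ?(eqP f0) ?capv0 /=.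
have fE x : (f @: sharp A x)%VS = sharp A' x.
  apply/eqP; rewrite eqEsubv; apply/andP; split.
    by apply/subvP=> _ /memv_imgP[m ms ->]; apply/fS.
  apply/subvP=> m; have /memv_imgP[m' _ ->] : m \in limg f by rewrite fT memvf.
  by move/fS; apply: memv_img.
by rewrite (super_gradingE HA g 0) (super_gradingE HA' g 0) limgD !fE.
Qed.

Lemma iso_sharp A A' (f : 'End('M[F]_(n + n))) : lker f == 0%VS ->
    (forall i, (f @: Mnn_part F n i)%VS = Mnn_part F n i) ->
    (forall g, (f @: A g)%VS = A' g) ->
  forall x m, m \in sharp A x <-> f m \in sharp A' x.
Proof.
move=> f0 fP fA x m.
have fV (U : {vspace 'M[F]_(n + n)}) : (f m \in (f @: U)%VS) = (m \in U).
  apply/idP/idP; last exact: memv_img.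
  by case/memv_imgP=> m' m'U /(lker0P f0)->.
by rewrite /sharp !memv_cap -fA -{2}(fP x.2) !fV; split.
Qed.

End SharpIso.

(** * The parameters *)

Section Cyc.
Variables (G : zmodType) (t0 : G).

Lemma barB x y : bar t0 (x - y) = bar t0 x - bar t0 y.
Proof. exact: raddfB. Qed.

Lemma barD x y : bar t0 (x + y) = bar t0 x + bar t0 y.
Proof. exact: raddfD. Qed.

Lemma bar0 : bar t0 0 = 0.
Proof. by rewrite -(subrr 0) barB subrr. Qed.

Lemma bar_repr (y : Gbar t0) : bar t0 (repr y) = y.
Proof. exact: reprK. Qed.

Lemma bar_eq x y : (bar t0 x == bar t0 y) = (x - y \in cyc t0).
Proof. by rewrite (Quotient.idealrBE (cyc t0)). Qed.

Lemma bar_eq0 x : (bar t0 x == 0) = (x \in cyc t0).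
Proof. by rewrite -bar0 bar_eq subr0. Qed.

Hypothesis t0_2 : has_order2 t0.

Lemma cycP x : reflect (x = 0 \/ x = t0) (x \in cyc t0).
Proof.
case: t0_2 => _ t02; apply: (iffP (asboolP _)) => [[m ->]|[]->]; last 2 first.
- by exists 0; rewrite mulr0z.
- by exists 1.
have E (j : nat) : t0 *+ j = 0 \/ t0 *+ j = t0.
  rewrite -(odd_double_half j) mulrnDr -mul2n mulrnA t02 mul0rn addr0.
  by case: (odd j); [right | left].
case: m => j; first exact: E.
rewrite NegzE mulrNz -pmulrn; case: (E j.+1) => ->; first by left; rewrite oppr0.
by right; apply/eqP; rewrite eq_sym -addr_eq0 -mulr2n t02.
Qed.

Lemma bar_t0 : bar t0 t0 = 0.
Proof. by apply/eqP; rewrite bar_eq0; apply/cycP; right. Qed.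

End Cyc.

Section Tplus.
Variables (F : fieldType) (G : zmodType) (t0 : G) (Tbar : {fset Gbar t0}).
Hypotheses (t0_2 : has_order2 t0) (TbarZ : zmod_closed [pred x in Tbar]).
Local Notation Tp := (Tplus Tbar).

Lemma mem_Tplus x : (x \in Tp) = (bar t0 x \in Tbar). Proof. by []. Qed.

Lemma Tplus_zmod_closed : zmod_closed Tp.
Proof.
case: TbarZ => T0 TB; split=> [|x y xT yT]; rewrite mem_Tplus ?bar0 //.
by rewrite barB; apply: TB.
Qed.

Lemma cyc_Tplus x : x \in cyc t0 -> x \in Tp.
Proof. by rewrite -bar_eq0 mem_Tplus => /eqP->; case: TbarZ. Qed.

Section Betaplus.
Variable beta : Gbar t0 -> Gbar t0 -> F.
Hypothesis betaP : is_nondeg_alt_bichar [pred x in Tbar] beta.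

Lemma betaplus_cyc x t : x \in cyc t0 -> t \in Tp -> betaplus beta x t = 1.
Proof.
rewrite -bar_eq0 /betaplus => /eqP-> tT; case: betaP => _ br _ _.
by case: TbarZ => T0 _; rewrite (character0 T0 (br _ tT)).
Qed.

Lemma betaplus_radical x :
  x \in Tp -> {in Tp, forall t, betaplus beta x t = 1} -> x \in cyc t0.
Proof.
move=> xT x1; rewrite -bar_eq0; apply/eqP; case: betaP => _ _ _; apply=> // y yT.
by rewrite -[y]bar_repr; apply: x1; rewrite mem_Tplus bar_repr.
Qed.

End Betaplus.

Variable u : G.

Lemma mem_T_u x : (x \in T_u Tbar u) =
  if x.2 == 0 then x.1 \in Tp else x.1 - u \in Tp.
Proof.
rewrite /T_u inE /Tplus_sharp !inE /=.
by case: (Z2_cases x.2) => ->; rewrite /= ?andbF ?andbT ?orbF.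
Qed.

Lemma T_u_even x : ((x, 0) \in T_u Tbar u) = (x \in Tp).
Proof. by rewrite mem_T_u. Qed.

Lemma T_u_t1 : t1 u \in T_u Tbar u.
Proof. by rewrite mem_T_u /= subrr; case: Tplus_zmod_closed. Qed.

(** The condition on [u *+ 2] serves the difference of an even and an odd element, which is
    [- u *+ 2] away from the required coset. *)
Lemma T_u_zmod_closed : u *+ 2 \in Tp -> zmod_closed (T_u Tbar u).
Proof.
have [T0 TB] := Tplus_zmod_closed.
move=> uT; split=> [|[x i] [y j]]; rewrite ?mem_T_u //=.
case: (Z2_cases i) => ->; case: (Z2_cases j) => -> /= xT yT.
- exact: TB.
- have -> : x - y - u = x - (y - u) - u *+ 2.
    by rewrite mulr2n !opprD opprK !addrA addrK.
  by apply: (TB) uT; apply: (TB).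
- by rewrite addrAC; apply: (TB).
- have -> : x - y = (x - u) - (y - u) by rewrite opprB addrA subrK.
  exact: TB.
Qed.

End Tplus.

Lemma T_u_congr (G : zmodType) (t0 : G) (Tbar : {fset Gbar t0}) (u u' : G) :
    zmod_closed [pred x in Tbar] -> u - u' \in cyc t0 ->
  T_u Tbar u =i T_u Tbar u'.
Proof.
move=> TbarZ uu' x; rewrite !mem_T_u; case: ifP => // _.
by rewrite !mem_Tplus !barB; move: uu'; rewrite -bar_eq => /eqP->.
Qed.

(** * The bicharacter extending [betaplus] to [T_u] *)

Section BetaU.
Variables (F : fieldType) (G : zmodType).
Variable chi : forall t0 : G, {fset Gbar t0} -> G -> F.
Variables (t0 : G) (Tbar : {fset Gbar t0}).
Hypotheses (t0_2 : has_order2 t0) (TbarZ : zmod_closed [pred x in Tbar]).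
Local Notation Tp := (Tplus Tbar).

(** Changing [u] by an element of [cyc t0] multiplies [b (t1 u)] on even elements by a value of
    [betaplus] on its radical, which is 1. *)
Lemma is_beta_u_shift (beta : Gbar t0 -> Gbar t0 -> F) u u' b :
    is_nondeg_alt_bichar [pred x in Tbar] beta ->
    u - u' \in cyc t0 -> is_beta_u chi Tbar beta u' b -> is_beta_u chi Tbar beta u b.
Proof.
move=> betaP uu' [bP b_even b_t1].
have TE := T_u_congr TbarZ uu'.
have uT : u - u' \in Tp by apply: cyc_Tplus.
split=> // [|t tT].
  by apply: nondeg_alt_bichar_congr bP => x; rewrite TE.
have -> : t1 u = (u - u', 0) + t1 u'.
  by rewrite /t1; congr (_, _); rewrite /= ?subrK ?add0r.
have tT' : (t, 0) \in T_u Tbar u' by rewrite T_u_even.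
case: bP => _ br _ _; have [_ cD] := br _ tT'.
rewrite cD ?T_u_even //; last exact: T_u_t1.
by rewrite b_even // (betaplus_cyc TbarZ betaP) // mul1r b_t1.
Qed.

(** [T_u] is generated by its even part and [t1 u]. The values on even pairs and on [t1 u] against
    even elements are prescribed; alternation fixes the reversed pairs and [b (t1 u) (t1 u)]. *)
Lemma is_beta_u_unique (beta beta' : Gbar t0 -> Gbar t0 -> F) u b b' :
    u *+ 2 \in Tp -> {in Tbar &, beta =2 beta'} ->
    is_beta_u chi Tbar beta u b -> is_beta_u chi Tbar beta' u b' ->
  {in T_u Tbar u &, b =2 b'}.
Proof.
move=> uT bb' [bP be b1] [bP' be' b1'].
have TuZ := T_u_zmod_closed TbarZ uT.
have t1T := T_u_t1 TbarZ u.
have evenE : {in Tp &, forall s t, b (s, 0) (t, 0) = b' (s, 0) (t, 0)}.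
  by move=> s t sT tT; rewrite be // be' // /betaplus bb'.
have t1E : {in Tp, forall t, b (t1 u) (t, 0) = b' (t1 u) (t, 0)}.
  by move=> t tT; rewrite b1 // b1'.
have split_T_u x : x \in T_u Tbar u ->
    exists2 s, s \in Tp & x = (s, 0) \/ x = (s, 0) + t1 u.
  case: x => x i; rewrite mem_T_u /=; case: (Z2_cases i) => -> /= xT.
    by exists x => //; left.
  by exists (x - u) => //; right; rewrite /t1; congr (_, _); rewrite /= ?subrK ?add0r.
have evenE' s y : s \in Tp -> y \in T_u Tbar u -> b (s, 0) y = b' (s, 0) y.
  move=> sT /[dup] yT /split_T_u[t tT yE].
  have sT' : (s, 0) \in T_u Tbar u by rewrite T_u_even.
  have tT' : (t, 0) \in T_u Tbar u by rewrite T_u_even.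
  case: yE => ->; first exact: evenE.
  case: (bP) (bP') => bl _ _ _ [bl' _ _ _].
  have [[_ bD] [_ bD']] := (bl _ sT', bl' _ sT'); rewrite bD // bD' // evenE //.
  by rewrite !(alt_bicharV TuZ bP t1T sT', alt_bicharV TuZ bP' t1T sT') t1E.
move=> x y /split_T_u[s sT xE] yT.
have sT' : (s, 0) \in T_u Tbar u by rewrite T_u_even.
case: xE => ->; first exact: evenE'.
case: (bP) (bP') => bl br balt _ [bl' br' balt' _].
have [[_ bD] [_ bD']] := (br _ yT, br' _ yT); rewrite bD // bD' // evenE' //.
congr (_ * _); have [t tT yE] := split_T_u _ yT.
have tT' : (t, 0) \in T_u Tbar u by rewrite T_u_even.
case: yE => ->; first exact: t1E.
have [[_ cD] [_ cD']] := (bl _ t1T, bl' _ t1T).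
by rewrite cD // cD' // t1E // balt // balt'.
Qed.

End BetaU.

Lemma is_associated_congr (F : fieldType) (K : zmodType) (T T' : {pred K})
    (b b' : K -> K -> F) (D : falgType F) (Dg : K -> {vspace D}) :
    T =i T' -> {in T &, b =2 b'} ->
  is_associated T b Dg -> is_associated T' b' Dg.
Proof.
move=> TT' bb' [D1 D2 D3 D4 D5]; split=> // [t|t|s t].
- by rewrite -TT'.
- by rewrite -TT'; apply: D4.
- by rewrite -!TT' => sT tT x y xs yt; rewrite -bb' //; apply: D5.
Qed.

(** * Isomorphism of the gradings [Gamma] *)

Section IsomInvariants.
Variables (F : closedFieldType) (K : zmodType) (D D' : falgType F).
Variables (T T' : {pred K}) (b b' : K -> K -> F).
Variables (Dg : K -> {vspace D}) (Dg' : K -> {vspace D'}).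
Hypotheses (HD : is_associated T b Dg) (HD' : is_associated T' b' Dg').
Variables (k k' : nat) (g : 'I_k.+1 -> K) (g' : 'I_k' -> K).
Variables (psi : 'M[D]_k.+1 -> 'M[D']_k') (psi' : 'M[D']_k' -> 'M[D]_k.+1).
Hypotheses (psiK : cancel psi psi') (psi'K : cancel psi' psi).
Hypothesis psiD : forall X Y, psi (X + Y) = psi X + psi Y.
Hypothesis psiZ : forall c X, psi (map_mx ( *:%R c) X) = map_mx ( *:%R c) (psi X).
Hypothesis psiM : forall X Y, psi (X *m Y) = psi X *m psi Y.
Hypothesis psiP : forall x X, homog_mx Dg g g x X <-> homog_mx Dg' g' g' x (psi X).

Let GD : graded_division Dg. Proof. by case: HD. Qed.
Let GD' : graded_division Dg'. Proof. by case: HD'. Qed.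

Let psiZ' c X : psi (c%:A *: X) = c%:A *: psi X.
Proof. by rewrite -!map_mx_scale. Qed.

(** The corner map sends nonzero homogeneous elements to nonzero ones of the same degree and keeps
    their commutation factor. The other inclusion of supports comes from exchanging [psi] and
    [psi']. *)
Lemma isom_support_bichar : {in T &, forall s t, s \in T' /\ b s t = b' s t}.
Proof.
move=> s t sT tT.
have [h [w [w' [wD w'D w'w ww']]]] := corner_equivalence GD GD' psiK psi'K psiD psiM psiP.
pose th := corner_map psi w w'.
have thM x y : th (x * y) = th x * th y := corner_mapM psiM ww' x y.
have thZ c x : th (c *: x) = c *: th x := corner_mapZ psiZ' w w' c x.
have thD r x : x \in Dg r -> th x \in Dg' r.
  exact: (corner_map_homog GD' psiP wD w'D).
have th0 x : th x = 0 -> x = 0 by apply: (corner_map_eq0 psiK psiD psiM ww').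
have pickT r : r \in T -> exists x, [/\ x \in Dg r, th x \in Dg' r & th x != 0].
  move=> rT; exists (vpick (Dg r)); split; rewrite ?thD ?memv_pick //.
  apply: contraTneq rT => /th0/eqP; rewrite vpick0 => r0.
  by case: HD => _ _ -> _ _; rewrite negbK.
have supp r : r \in T -> r \in T'.
  move=> /pickT[x [_ xr x0]]; case: HD' => _ _ -> _ _.
  exact (homog_neq0 xr x0).
split; first exact: supp.
have [x [xs xs' x0]] := pickT s sT; have [y [yt yt' y0]] := pickT t tT.
have xy : th x * th y = b s t *: (th y * th x).
  by rewrite -!thM -thZ; congr th; case: HD => _ _ _ _; apply.
case: HD' => _ _ _ _ /(_ s t (supp s sT) (supp t tT) _ _ xs' yt').
rewrite xy => /eqP; rewrite -subr_eq0 -scalerBl scaler_eq0.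
rewrite (homogM_eq0 GD' yt' xs') (negPf x0) (negPf y0) !orbF subr_eq0.
by move/eqP.
Qed.

Lemma isom_count : exists h, forall x,
  #|[pred i | Dg (- g i + x) != 0%VS]| = #|[pred j | Dg' (- g' j + (x + h)) != 0%VS]|.
Proof.
have [h [w [w' [wD w'D w'w ww']]]] := corner_equivalence GD GD' psiK psi'K psiD psiM psiP.
exists (h - g ord0) => x.
have e1 : x - g ord0 + h = x + (h - g ord0) by rewrite -addrA (addrC (- _)).
have e2 : x + (h - g ord0) - h + g ord0 = x.
  by rewrite addrA (addrAC (x + h)) addrK subrK.
apply/eqP; rewrite eqn_leq; apply/andP; split.
  have := corner_count_le GD GD' psiK psiD psiZ' psiM psiP wD ww' x.
  by rewrite e1.
have := corner_count_ge GD GD' psiK psi'K psiD psiZ' psiM psiP w'D w'w ww'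
  (x + (h - g ord0)).
by rewrite e2.
Qed.

End IsomInvariants.

Lemma Xi_card (G : zmodType) (T : {pred G}) k (gamma : k.-tuple G) x :
  Xi T gamma x = #|[pred i | tnth gamma i - x \in T]|.
Proof. by rewrite /Xi -sum1_count big_tuple -sum1_card. Qed.

(** Replacing each entry by a canonical representative of its coset turns equality of multiplicities
    into [perm_eq] of two tuples. *)
Lemma Xi_perm (G : zmodType) (T : {pred G}) k (gamma gamma' : k.-tuple G) g :
    zmod_closed T -> translate g (Xi T gamma) =1 Xi T gamma' ->
  exists s : 'S_k, forall i, - tnth gamma' i + g + tnth gamma (s i) \in T.
Proof.
move=> [T0 TB] XiE.
have TN x : x \in T -> - x \in T by move=> xT; rewrite -sub0r; apply: (TB).
pose canon x := choose [pred y | y - x \in T] x.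
have canonP x : canon x - x \in T.
  by apply: (@chooseP _ [pred y | y - x \in T]); rewrite /= subrr.
have canonE x y : (canon x == canon y) = (x - y \in T).
  apply/eqP/idP=> [xy|xy].
    have := TB _ _ (canonP y) (canonP x); rewrite xy.
    by rewrite opprB addrC addrA subrK.
  rewrite /canon (@choose_id _ _ x y) ?inE ?subrr //.
    apply: eq_choose => z; rewrite !inE; apply/idP/idP=> zT.
      have -> : z - y = (z - x) - (y - x) by rewrite opprB addrA subrK.
      by apply: (TB) => //; rewrite -opprB; apply: TN.
    have -> : z - x = (z - y) - (x - y) by rewrite opprB addrA subrK.
    exact: TB.
  by rewrite -opprB; apply: TN.
pose r := [tuple canon (tnth gamma i + g) | i < k].
pose r' := [tuple canon (tnth gamma' i) | i < k].
have countE k0 (d : k0.-tuple G) z :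
    count_mem (canon z) [tuple canon (tnth d i) | i < k0] = Xi T d z.
  rewrite Xi_card -sum1_count big_tuple -sum1_card; apply: eq_bigl => i.
  by rewrite tnth_mktuple /= canonE.
have rr' : perm_eq r' r.
  apply/allP=> z; rewrite mem_cat => zrr'; apply/eqP.
  have [x ->] : exists x, z = canon x.
    by case/orP: zrr' => /mapP[i _ ->]; eexists.
  rewrite countE -XiE /translate Xi_card -sum1_count big_tuple -sum1_card.
  by apply/esym/eq_bigl => i; rewrite tnth_mktuple /= canonE inE opprB addrA.
have [s sE] := tuple_permP rr'; exists s => i.
have : tnth r' i = tnth [tuple tnth r (s i) | i < k] i by congr tnth; apply: val_inj.
rewrite !tnth_mktuple => /eqP; rewrite canonE => /TN.
by rewrite opprB addrC (addrC (tnth gamma _)) addrA.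
Qed.

(** * Recovering the parameters from the support and the bicharacter *)

Section SameParameters.
Variables (F : closedFieldType) (G : zmodType).
Variable chi : forall t0 : G, {fset Gbar t0} -> G -> F.
Local Notation Gsharp := (G * 'Z_2)%type.
Variables (t0 : G) (Tbar : {fset Gbar t0}) (beta : Gbar t0 -> Gbar t0 -> F) (u : G).
Variables (t0' : G) (Tbar' : {fset Gbar t0'}) (beta' : Gbar t0' -> Gbar t0' -> F) (u' : G).
Hypotheses (t0_2 : has_order2 t0) (TbarZ : zmod_closed [pred x in Tbar]).
Hypothesis betaP : is_nondeg_alt_bichar [pred x in Tbar] beta.
Hypotheses (t0'_2 : has_order2 t0') (Tbar'Z : zmod_closed [pred x in Tbar']).
Hypothesis beta'P : is_nondeg_alt_bichar [pred x in Tbar'] beta'.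
Hypotheses (u2 : u *+ 2 \in Tplus Tbar) (u'2 : u' *+ 2 \in Tplus Tbar').
Variables b b' : Gsharp -> Gsharp -> F.
Hypotheses (bP : is_beta_u chi Tbar beta u b) (b'P : is_beta_u chi Tbar' beta' u' b').
Variables (k k' : nat) (gamma : k.-tuple G) (gamma' : k'.-tuple G).

Lemma same_parametersI (h : Gsharp) :
    T_u Tbar u =i T_u Tbar' u' -> {in T_u Tbar u &, b =2 b'} ->
    (forall x, #|[pred i | - (tnth gamma i, 0) + x \in T_u Tbar u]| =
               #|[pred j | - (tnth gamma' j, 0) + (x + h) \in T_u Tbar' u']|) ->
  same_parameters Tbar beta u gamma Tbar' beta' u' gamma'.
Proof.
move=> TT' bb' cnt.
have TpE x : (x \in Tplus Tbar) = (x \in Tplus Tbar').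
  by rewrite -(T_u_even _ u) TT' T_u_even.
have betaE : {in Tplus Tbar &, forall s t, betaplus beta s t = betaplus beta' s t}.
  move=> s t sT tT; case: (bP) (b'P) => _ be _ [_ be' _].
  by rewrite -be // -be' -?TpE // bb' ?T_u_even.
have t0T : t0 \in cyc t0 by apply/cycP=> //; right.
(* [t0] lies in the radical of [betaplus beta], which is also that of [betaplus beta'], namely
   [cyc t0']. Being nonzero, it is [t0']. *)
have t0T' : t0 \in cyc t0'.
  apply: (betaplus_radical beta'P) => [|t tT'].
    by rewrite -TpE; apply: cyc_Tplus.
  rewrite -TpE in tT'; rewrite -betaE //; last exact: cyc_Tplus.
  exact: (betaplus_cyc TbarZ betaP).
have t0E : t0 = t0'.
  by case: (cycP t0'_2 t0 t0T') => // t00; case: t0_2; rewrite t00 eqxx.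
(* The primed data depend on [t0'] through their types, so the equality is eliminated with all of
   them generalized. *)
case: _ / t0E Tbar' beta' t0'_2 Tbar'Z beta'P u'2 b'P cnt TT' TpE betaE {t0T'}
  => Tb' be' _ Tb'Z be'P u'2' b'P' cnt TT' TpE betaE.
have TbE : Tbar = Tb'.
  by apply/fsetP=> y; rewrite -[y]bar_repr -!mem_Tplus TpE.
case: _ / TbE Tb'Z be'P u'2' b'P' cnt TT' TpE betaE
  => _ be'P u'2' b'P' cnt TT' _ betaE.
split.
- exists erefl; split=> //= x y xT yT.
  by rewrite -[x]bar_repr -[y]bar_repr; apply: betaE; rewrite mem_Tplus bar_repr.
- have u'T : t1 u' \in T_u Tbar u by rewrite TT'; apply: T_u_t1.
  have uT := T_u_t1 TbarZ u.
  have uu'T : u - u' \in Tplus Tbar.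
    have [_ TB] := T_u_zmod_closed TbarZ u2; have := TB _ _ uT u'T.
    by rewrite mem_T_u.
  apply: (betaplus_radical betaP) => // t tT.
  case: (bP) (b'P') => bnd be b1 [_ _ b1'].
  have tT' : (t, 0) \in T_u Tbar u by rewrite T_u_even.
  have uu'T' : (u - u', 0) \in T_u Tbar u by rewrite T_u_even.
  case: (bnd) => _ br _ _; have [b0 bD] := br _ tT'.
  (* Once [t0] and [Tbar] agree, [t1 u] and [t1 u'] both pair with even elements through the same
     character [chi], so their difference pairs trivially. *)
  apply: (mulIf (b0 _ u'T)); rewrite -be // -bD // mul1r (bb' (t1 u')) //.
  rewrite b1' // -b1 //; congr (b _ _).
  by rewrite /t1; congr (_, _); rewrite /= ?subrK ?add0r.
- have [h' cnt'] : exists h', forall x,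
      #|[pred i | - (tnth gamma i, 0) + x \in T_u Tbar u]| =
      #|[pred j | - (tnth gamma' j, 0) + (x + (h', 0)) \in T_u Tbar u]|.
    case: h cnt => h i cnt; case: (Z2_cases i) cnt => -> cnt.
      by exists h => x; rewrite cnt; apply: eq_card => j; apply: (esym (TT' _)).
    (* An odd shift is made even by adding [t1 u], which lies in [T_u] and so does not affect
       membership. *)
    exists (h + u) => x; rewrite cnt; apply: eq_card => j.
    apply: etrans (esym (TT' _)) _.
    rewrite -[RHS]/(- (tnth gamma' j, 0) + (x + (h + u, 0)) \in T_u Tbar u).
    have -> : (h + u, 0) = (h, 1) + t1 u :> Gsharp.
      by rewrite /t1; congr (_, _); apply: val_inj.
    have [T0 TB] := T_u_zmod_closed TbarZ u2; have uT := T_u_t1 TbarZ u.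
    rewrite !addrA; set y := _ + (h, 1); apply/idP/idP=> yT.
      by rewrite -[t1 u]opprK; apply: (TB) => //; rewrite -sub0r; apply: (TB).
    by rewrite -[y](addrK (t1 u)); apply: (TB).
  exists h' => x; rewrite /translate !Xi_card.
  have := cnt' (x - h', 0); have [T0 TB] := Tplus_zmod_closed TbarZ.
  have TN y : (y \in Tplus Tbar) = (- y \in Tplus Tbar).
    by apply/idP/idP=> yT; [|rewrite -[y]opprK]; rewrite -sub0r; apply: (TB).
  have -> : (x - h', 0) + (h', 0) = (x, 0) :> Gsharp.
    by congr (_, _); rewrite /= ?subrK ?addr0.
  have evenE (y z : G) : (- (y, 0) + (z, 0) \in T_u Tbar u) = (y - z \in Tplus Tbar).
    have -> : - (y, 0) + (z, 0) = (z - y, 0) :> Gsharp.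
      by congr pair; [apply: addrC | apply: val_inj].
    by rewrite T_u_even TN opprB.
  rewrite (eq_card (B := [pred i | tnth gamma i - (x - h') \in Tplus Tbar])).
    move=> ->; apply: eq_card => j; exact: evenE.
  by move=> i; apply: evenE.
Qed.

End SameParameters.

(** * The isomorphism criterion for the gradings with given parameters *)

Section GammaIso.
Variables (F : closedFieldType) (G : zmodType) (n : nat).
Hypothesis n_ge1 : (1 <= n)%N.
Variable chi : forall t0 : G, {fset Gbar t0} -> G -> F.
Implicit Types A : G -> {vspace 'M[F]_(n + n)}.

Lemma isomorphic_same_parameters (t0 : G) (Tbar : {fset Gbar t0}) beta u
    (t0' : G) (Tbar' : {fset Gbar t0'}) beta' u' k (gamma : k.-tuple G)
    k' (gamma' : k'.-tuple G) A A' :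
    admissible n chi Tbar beta u k -> admissible n chi Tbar' beta' u' k' ->
    is_Gamma chi Tbar beta u gamma A -> is_Gamma chi Tbar' beta' u' gamma' A' ->
  gradings_isomorphic A A' -> same_parameters Tbar beta u gamma Tbar' beta' u' gamma'.
Proof.
(* The corner argument uses a first matrix unit; the sizes are positive because [n] is. *)
case: k gamma => [|k] gamma.
  by case=> _ _ _ _ [l _ n0]; exfalso; have := n_ge1; rewrite -n0.
case: k' gamma' => [|k'] gamma'.
  by move=> _ [_ _ _ _ [l _ n0]]; exfalso; have := n_ge1; rewrite -n0.
move=> [t02 TbZ bP [a [aT _ _] ua] _] [t02' TbZ' bP' [a' [aT' _ _] ua'] _].
move=> [HA [b [D [Dg [phi [bu HD [phi1 phiK phi1K] [phiD phiZ phiM] phiP]]]]]].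
move=> [HA' [b' [D' [Dg' [phi' [bu' HD' [phi1' phiK' phi1K'] [phiD' phiZ' phiM'] phiP']]]]]].
move=> [f [f0 fM fP fA]]; have fS := iso_sharp f0 fP fA.
have fT : limg f = fullv.
  by apply/eqP; rewrite eqEdim subvf limg_dim_eq ?(eqP f0) ?capv0 /=.
pose psi X := phi' (f (phi1 X)); pose psi' Y := phi (f^-1%VF (phi1' Y)).
have psiK : cancel psi psi' by move=> X; rewrite /psi' /psi phiK' lker0_lfunK.
have psi'K : cancel psi' psi.
  by move=> Y; rewrite /psi /psi' phiK limg_lfunVK ?fT ?memvf.
have phi1D X Y : phi1 (X + Y) = phi1 X + phi1 Y.
  by apply: (can_inj phiK); rewrite phiD !phi1K.
have phi1Z c X : phi1 (map_mx ( *:%R c) X) = c *: phi1 X.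
  by apply: (can_inj phiK); rewrite phiZ !phi1K.
have phi1M X Y : phi1 (X *m Y) = phi1 X *m phi1 Y.
  by apply: (can_inj phiK); rewrite phiM !phi1K.
have psiD X Y : psi (X + Y) = psi X + psi Y by rewrite /psi phi1D linearD phiD'.
have psiZ c X : psi (map_mx ( *:%R c) X) = map_mx ( *:%R c) (psi X).
  by rewrite /psi phi1Z linearZ phiZ'.
have psiM X Y : psi (X *m Y) = psi X *m psi Y by rewrite /psi phi1M fM phiM'.
pose g i : G * 'Z_2 := (tnth gamma i, 0); pose g' i : G * 'Z_2 := (tnth gamma' i, 0).
have psiP x X : homog_mx Dg g g x X <-> homog_mx Dg' g' g' x (psi X).
  apply: iff_trans (phiP' x _); apply: iff_trans (fS x _).
  by rewrite -{1}[X]phi1K; apply: iff_sym; apply: phiP.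
have psi_inj := can_inj psiK.
have psi'D X Y : psi' (X + Y) = psi' X + psi' Y.
  by apply: psi_inj; rewrite psiD !psi'K.
have psi'Z c X : psi' (map_mx ( *:%R c) X) = map_mx ( *:%R c) (psi' X).
  by apply: psi_inj; rewrite psiZ !psi'K.
have psi'M X Y : psi' (X *m Y) = psi' X *m psi' Y.
  by apply: psi_inj; rewrite psiM !psi'K.
have psi'P x X : homog_mx Dg' g' g' x X <-> homog_mx Dg g g x (psi' X).
  by rewrite -{1}[X]psi'K; apply: iff_sym; apply: psiP.
have TT' := isom_support_bichar HD HD' psiK psi'K psiD psiZ psiM psiP.
have T'T := isom_support_bichar HD' HD psi'K psiK psi'D psi'Z psi'M psi'P.
have [h cnt] := isom_count HD HD' psiK psi'K psiD psiZ psiM psiP.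
have u2 : u *+ 2 \in Tplus Tbar by rewrite ua.
have u2' : u' *+ 2 \in Tplus Tbar' by rewrite ua'.
apply (same_parametersI t02 TbZ bP t02' TbZ' bP' u2 u2' bu bu') with (h := h).
- by move=> x; apply/idP/idP=> xT; [case: (TT' x x) | case: (T'T x x)].
- by move=> x y xT yT; case: (TT' x y).
- move=> x; case: (HD) (HD') => _ _ TE _ _ [_ _ TE' _ _].
  rewrite (eq_card (B := [pred i | Dg (- g i + x) != 0%VS])); last by move=> i; apply: TE.
  by rewrite cnt; apply: eq_card => i; apply/esym/TE'.
Qed.

Lemma isomorphic_of_same_bar (t0 : G) (Tbar : {fset Gbar t0}) beta u beta' u'
    k (gamma : k.-tuple G) k' (gamma' : k'.-tuple G) g A A' :
    admissible n chi Tbar beta u k -> admissible n chi Tbar beta' u' k' ->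
    is_Gamma chi Tbar beta u gamma A -> is_Gamma chi Tbar beta' u' gamma' A' ->
    {in Tbar &, beta =2 beta'} -> u - u' \in cyc t0 ->
    translate g (Xi (Tplus Tbar) gamma) =1 Xi (Tplus Tbar) gamma' ->
  gradings_isomorphic A A'.
Proof.
move=> [t02 TbZ bP [a [aT _ _] ua] [l lT kl]] [_ _ bP' _ [l' lT' kl']].
(* Both [l] and [l'] are the square root of the order of [Tbar], and [k * l = n = k' * l'] is
   positive. *)
have {l' lT' kl'} kk' : k = k'.
  have ll' : l' = l by apply/eqP; rewrite -(eqn_exp2r _ _ (isT : 0 < 2)%N) lT lT'.
  have l0 : (0 < l)%N by rewrite lt0n; apply: contraTneq n_ge1 => l0; rewrite -kl l0 muln0.
  by apply/eqP; rewrite -(eqn_pmul2r l0) kl -kl' ll'.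
case: k' / kk' gamma' => gamma'.
move=> [HA [b [D [Dg [phi [bu HD [phi1 phiK phi1K] [phiD phiZ phiM] phiP]]]]]].
move=> [HA' [b' [D' [Dg' [phi' [bu' HD' [phi1' phiK' phi1K'] [phiD' phiZ' phiM'] phiP']]]]]].
move=> bb' uu' XiE.
have u2 : u *+ 2 \in Tplus Tbar by rewrite ua.
have TE := T_u_congr TbZ uu'.
have bE : {in T_u Tbar u &, b =2 b'}.
  exact (is_beta_u_unique TbZ u2 bb' bu (is_beta_u_shift TbZ bP' uu' bu')).
have HD'u : is_associated (T_u Tbar u) b Dg'.
  apply: is_associated_congr HD' => x; rewrite -TE // => y xT.
  by rewrite -TE => yT; rewrite bE.
have [s sT] := Xi_perm (Tplus_zmod_closed TbZ) XiE.
pose d i : G * 'Z_2 := (tnth gamma i, 0); pose d' i : G * 'Z_2 := (tnth gamma' i, 0).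
have ds i : - d' i + (g, 0) + d (s i) \in T_u Tbar u.
  have -> : - d' i + (g, 0) + d (s i) = (- tnth gamma' i + g + tnth gamma (s i), 0).
    by congr pair; apply: val_inj.
  by rewrite T_u_even sT.
have [psi [[psi' psiK psi'K] psiD psiZ psiM psiP]] := graded_mx_iso HD HD'u ds.
have phi1D X Y : phi1' (X + Y) = phi1' X + phi1' Y.
  by apply: (can_inj phiK'); rewrite phiD' !phi1K'.
have phi1Z c X : phi1' (map_mx ( *:%R c) X) = c *: phi1' X.
  by apply: (can_inj phiK'); rewrite phiZ' !phi1K'.
have phi1M X Y : phi1' (X *m Y) = phi1' X *m phi1' Y.
  by apply: (can_inj phiK'); rewrite phiM' !phi1K'.
have [f fE] : exists f : 'End('M[F]_(n + n)), forall m, f m = phi1' (psi (phi m)).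
  by apply: linear_hom => c x y; rewrite phiD phiZ psiD psiZ phi1D phi1Z.
apply: (sharp_iso (f := f) HA HA').
- apply/lker0P => x y; rewrite !fE => /(can_inj phi1K')/(can_inj psiK).
  exact: can_inj.
- by move=> x y; rewrite !fE phiM psiM phi1M.
- move=> x m; rewrite fE; apply: iff_trans (phiP x m) _.
  apply: iff_trans (psiP x _) _; apply: iff_sym.
  by apply: iff_trans (phiP' x _) _; rewrite phi1K'.
Qed.

Lemma same_parameters_isomorphic (t0 : G) (Tbar : {fset Gbar t0}) beta u
    (t0' : G) (Tbar' : {fset Gbar t0'}) beta' u' k (gamma : k.-tuple G)
    k' (gamma' : k'.-tuple G) A A' :
    admissible n chi Tbar beta u k -> admissible n chi Tbar' beta' u' k' ->
    is_Gamma chi Tbar beta u gamma A -> is_Gamma chi Tbar' beta' u' gamma' A' ->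
  same_parameters Tbar beta u gamma Tbar' beta' u' gamma' -> gradings_isomorphic A A'.
Proof.
move=> adm adm' HA HA' [[e [TbE bE]] uu' [g XiE]].
case: t0' / e Tbar' beta' adm' HA' TbE bE XiE => Tbar' beta' adm' HA' /= TbE bE XiE.
case: Tbar' / TbE adm' HA' bE XiE => adm' HA' bE XiE.
exact: (isomorphic_of_same_bar adm adm' HA HA' bE uu' XiE).
Qed.

End GammaIso.

(** * Graded modules over graded division algebras *)

Section GradedModule.
Variables (F : closedFieldType) (K : zmodType) (D : falgType F) (U : vectType F).
Variables (Dg : K -> {vspace D}) (act : 'Hom(D, 'End(U))) (Ug : K -> {vspace U}).
Hypotheses (HD : graded_division Dg) (HU : is_graded_right_module Dg act Ug).

Lemma act1 v : act 1 v = v.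
Proof. by case: HU => -[-> _] _ _; rewrite id_lfunE. Qed.

Lemma actM d e v : act (d * e) v = act e (act d v).
Proof. by case: HU => -[_ ->] _ _; rewrite comp_lfunE. Qed.

Lemma act_homog g h v d : v \in Ug g -> d \in Dg h -> act d v \in Ug (g + h).
Proof. by case: HU => _ _; apply. Qed.

Lemma act_hom v : exists f : 'Hom(D, U), forall d, f d = act d v.
Proof. by apply: linear_hom => c d e; rewrite linearP /= add_lfunE scale_lfunE. Qed.

Lemma act_suml I (r : seq I) (P : pred I) (d : I -> D) v :
  act (\sum_(i <- r | P i) d i) v = \sum_(i <- r | P i) act (d i) v.
Proof.
have [f fE] := act_hom v; rewrite -fE linear_sum.
by apply: eq_bigr => i _; apply: fE.
Qed.

Lemma actD d e v : act (d + e) v = act d v + act e v.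
Proof. by rewrite linearD add_lfunE. Qed.

Lemma actZ c d v : act (c *: d) v = c *: act d v.
Proof. by rewrite linearZ scale_lfunE. Qed.

Lemma act0 v : act 0 v = 0.
Proof. by rewrite linear0 lfunE. Qed.

Lemma proj_act s p t q (Hp : homogeneous_projections Dg s p)
    (Hq : homogeneous_projections Ug t q) g h d v :
  v \in Ug h -> q (h + g) (act d v) = act (p g d) v.
Proof.
move=> vh; have [f fE] := act_hom v; rewrite -!fE addrC.
by apply: (proj_shift Hp Hq) => g' e eg; rewrite fE addrC; apply: act_homog.
Qed.

Definition act_free k (v : 'I_k -> U) : Prop :=
  forall d : 'I_k -> D, \sum_i act (d i) (v i) = 0 -> forall i, d i = 0.

Lemma act_comb_hom k (v : 'I_k -> U) : exists E : 'Hom({ffun 'I_k -> D}, U),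
  forall d, E d = \sum_i act (d i) (v i).
Proof.
apply: linear_hom => c d e; rewrite scaler_sumr -big_split /=.
by apply: eq_bigr => i _; rewrite !ffunE actD actZ.
Qed.

(** A free family embeds a power of [D] into [U], and [D] has positive dimension. *)
Lemma act_free_bound k (v : 'I_k -> U) : act_free v -> (k <= \dim {:U})%N.
Proof.
move=> vf; have [E EE] := act_comb_hom v.
have E0 : lker E == 0%VS.
  rewrite -subv0; apply/subvP=> d; rewrite memv_ker EE memv0 => /eqP/vf d0.
  by apply/eqP/ffunP=> i; rewrite d0 ffunE.
have : (\dim (limg E) <= \dim {:U})%N by rewrite dimvS ?subvf.
rewrite limg_dim_eq ?(eqP E0) ?capv0 //; apply: leq_trans.
rewrite [X in (_ <= X)%N]dimvf /dim /= card_ord leq_pmulr //.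
by have := adim_gt0 {:D}%AS; rewrite dimvf.
Qed.

(* A maximal [act_free] family generates: if a homogeneous [u] is not
   generated, neither is [u d] for any nonzero homogeneous [d]. *)
Lemma graded_basis (S : {pred K}) :
    (forall h, exists2 t, Dg t != 0%VS & h + t \in S) ->
  exists k (h : 'I_k -> K) (v : 'I_k -> U),
    [/\ forall i, h i \in S, forall i, v i \in Ug (h i), act_free v
      & forall u, exists d : {ffun 'I_k -> D}, u = \sum_i act (d i) (v i)].
Proof.
move=> HS.
have [s [p Hp]] := graded_division_projections HD.
have [t [q Hq]] : exists t q, homogeneous_projections Ug t q.
  by case: HU => _ /decomposition_projections.
pose Q k := `[< exists (h : 'I_k -> K) (v : 'I_k -> U),
  [/\ forall i, h i \in S, forall i, v i \in Ug (h i) & act_free v] >].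
have Q0 : exists k, Q k.
  by exists 0%N; apply/asboolP; exists (fun=> 0), (fun=> 0); split=> [[]|[]|d _ []].
have Qb k : Q k -> (k <= \dim {:U})%N.
  by move=> /asboolP[h [v [_ _]]]; apply: act_free_bound.
have [k /asboolP[h [v [hS vh vf]]] kmax] := ex_maxnP Q0 Qb.
exists k, h, v; split=> // u.
have [E EE] := act_comb_hom v.
suff : u \in limg E by case/memv_imgP=> d _ ->; exists d; rewrite EE.
have EA d x : x \in limg E -> act d x \in limg E.
  case/memv_imgP=> e _ ->; apply/memv_imgP; exists [ffun i => e i * d]; first exact: memvf.
  by rewrite !EE linear_sum; apply: eq_bigr => i _; rewrite ffunE actM.
have Eq g x : x \in limg E -> q g x \in limg E.
  case/memv_imgP=> e _ ->; apply/memv_imgP.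
  exists [ffun i => p (g - h i) (e i)]; first exact: memvf.
  rewrite !EE linear_sum; apply: eq_bigr => i _; rewrite ffunE.
  by rewrite -(proj_act Hp Hq _ _ (vh i)) addrC subrK.
rewrite [u](proj_sum Hq) memv_suml // => g _.
have := proj_mem Hq g u; move: (q g u) => {}u ug.
(* A unit [z] of degree [r] brings the degree of [u] into [S] without changing whether [u] is
   generated. *)
have [r r0 grS] := HS g; rewrite -vpick0 in r0.
set z := vpick (Dg r) in r0; have zr : z \in Dg r by apply: memv_pick.
have zU := homog_unit HD zr r0.
suff uE : act z u \in limg E.
  by rewrite -[u]act1 -(divrr zU) actM EA.
apply: contrapT => /negP uE.
suff /kmax : Q k.+1 by rewrite ltnn.
apply/asboolP; exists (fun i => if unlift ord0 i is Some j then h j else g + r).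
exists (fun i => if unlift ord0 i is Some j then v j else act z u); split.
- by move=> i; case: unliftP.
- by move=> i; case: unliftP => // _; apply: act_homog.
move=> d; rewrite big_ord_recl /= unlift_none.
under eq_bigr do rewrite liftK.
move=> d0.
have d00 : d ord0 = 0.
  have dE : act (d ord0) (act z u) \in limg E.
    rewrite -[act _ _](addrK (\sum_(i < k) act (d (lift ord0 i)) (v i))) d0 sub0r.
    rewrite memvN; apply/memv_imgP; exists [ffun i => d (lift ord0 i)].
      exact: memvf.
    by rewrite EE; apply: eq_bigr => i _; rewrite ffunE.
  (* A nonzero component of the new coefficient would be a unit; projecting to the corresponding
     degree and inverting that unit would put [act z u] in the span. *)
  apply: (proj_eq0 Hp) => x; apply/eqP; apply: contraNT uE => px.
  have pU := homog_unit HD (proj_mem Hp x (d ord0)) px.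
  rewrite -[act z u]act1 -(divrr pU) actM; apply: (EA).
  by rewrite -(proj_act Hp Hq _ _ (act_homog ug zr)) Eq.
move: d0; rewrite d00 act0 add0r => /vf dl i.
by case: (unliftP ord0 i) => [j|] ->.
Qed.

End GradedModule.

(** * Endomorphisms over [D] as matrices over [D] *)

Section EndMatrix.
Variables (F : closedFieldType) (G : zmodType) (n : nat).
Local Notation Gsharp := (G * 'Z_2)%type.
Variables (A : G -> {vspace 'M[F]_(n + n)}) (D : falgType F) (U : vectType F).
Variables (Dg : Gsharp -> {vspace D}) (act : 'Hom(D, 'End(U))).
Variables (Ug : Gsharp -> {vspace U}) (phi : 'Hom('M[F]_(n + n), 'End(U))).
Hypotheses (HD : graded_division Dg) (HU : is_graded_right_module Dg act Ug).
Hypothesis phiP : is_iso_to_EndD A act Ug phi.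

Lemma EndD_matrix : ~ (forall t, Dg t != 0%VS -> t.2 = 0) ->
  exists k (gamma : k.-tuple G) (Phi : 'M[F]_(n + n) -> 'M[D]_k),
    [/\ bijective Phi,
        [/\ forall x y, Phi (x + y) = Phi x + Phi y,
            forall c x, Phi (c *: x) = map_mx ( *:%R c) (Phi x)
          & forall x y, Phi (x *m y) = Phi x *m Phi y]
      & forall g x, x \in sharp A g <-> in_MkD_degree gamma Dg g (Phi x)].
Proof.
move=> odd; have [t1 t1D t1odd] : exists2 t, Dg t != 0%VS & t.2 != 0.
  apply: contrapT => nt; apply: odd => t tD; apply: contrapT => /eqP t0.
  by apply: nt; exists t.
(* A nonzero odd component of [D] shifts odd degrees to even ones, so every basis vector can be
   taken of even degree. *)
have [|k [h [v [hS vh vf vs]]]] := graded_basis HD HU (S := [pred x | x.2 == 0]).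
  move=> h; case: (Z2_cases h.2) => h2.
    by exists 0; [case: (supp_zmod_closed HD) | rewrite inE /= h2].
  exists t1 => //; rewrite inE /= h2.
  by case: (Z2_cases t1.2) t1odd => ->.
pose gamma := [tuple (h i).1 | i < k].
have hE i : h i = (tnth gamma i, 0).
  rewrite tnth_mktuple; have := hS i; rewrite inE => /eqP hi.
  by rewrite [LHS]surjective_pairing hi.
have /choice[c cE] := vs.
have cK d i : c (\sum_i act (d i) (v i)) i = d i.
  apply/subr0_eq; move: i; apply: vf.
  rewrite (eq_bigr (fun i => act (c (\sum_i act (d i) (v i)) i) (v i) -
     act (d i) (v i))); last by move=> i _; rewrite linearB add_lfunE opp_lfunE.
  by rewrite sumrB -cE subrr.
have c_uniq u d : u = \sum_i act (d i) (v i) -> forall i, c u i = d i.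
  by move=> -> i; apply: cK.
have cD u w i : c (u + w) i = c u i + c w i.
  apply: (c_uniq _ (fun i => c u i + c w i)); rewrite {1}(cE u) {1}(cE w) -big_split.
  by apply: eq_bigr => l _; rewrite actD.
have cZ a u i : c (a *: u) i = a *: c u i.
  apply: (c_uniq _ (fun i => a *: c u i)); rewrite {1}(cE u) scaler_sumr.
  by apply: eq_bigr => l _; rewrite actZ.
have cA d u i : c (act d u) i = c u i * d.
  apply: (c_uniq _ (fun i => c u i * d)); rewrite {1}(cE u) linear_sum.
  by apply: eq_bigr => l _; rewrite (actM HU).
have cv j i : c (v j) i = (i == j)%:R.
  apply: (c_uniq _ (fun i => (i == j)%:R)).
  rewrite (bigD1 j) //= eqxx (act1 HU) big1 ?addr0 // => l lj.
  by rewrite (negPf lj) act0.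
have [s [p Hp]] := graded_division_projections HD.
have [t [q Hq]] : exists t q, homogeneous_projections Ug t q.
  by case: HU => _ /decomposition_projections.
(* For homogeneous [u], keeping only the component of degree [x - h i] of each coordinate still
   gives coordinates of [u]; uniqueness concludes. *)
have c_homog x u i : u \in Ug x -> c u i \in Dg (x - h i).
  move=> ux; suff -> : c u i = p (x - h i) (c u i) by apply: (proj_mem Hp).
  apply: (c_uniq u (fun i => p (x - h i) (c u i))) => //.
  rewrite -{1}(proj_id Hq ux) {1}(cE u) linear_sum; apply: eq_bigr => j _.
  by rewrite -(proj_act HU Hp Hq _ _ (vh j)) addrC subrK.
case: (phiP) => phi0 phiM phiT phiS.
have phiE m d u : phi m (act d u) = act d (phi m u).
  by have [] := phiT (phi m) => /(_ (memv_img _ (memvf m)))->.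
pose Phi m : 'M[D]_k := \matrix_(i, j) c (phi m (v j)) i.
have phi_c m u : phi m u = \sum_i act (\sum_j Phi m i j * c u j) (v i).
  rewrite {1}(cE u) linear_sum.
  rewrite (eq_bigr (fun j => \sum_i act (Phi m i j * c u j) (v i))).
    by rewrite exchange_big; apply: eq_bigr => i _; rewrite act_suml.
  move=> j _; rewrite /= phiE {1}(cE (phi m (v j))) linear_sum.
  by apply: eq_bigr => i _; rewrite mxE (actM HU).
have Phi_inj : injective Phi.
  move=> m m' mm'; apply: (lker0P phi0); apply/lfunP=> u.
  by rewrite !phi_c mm'.
have /choice[Phi' Phi'K] : forall X, exists m, Phi m = X.
  move=> X; have [f fE] : exists f : 'End(U), forall u,
      f u = \sum_i act (\sum_j X i j * c u j) (v i).
    apply: linear_hom => a u w; rewrite scaler_sumr -big_split /=.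
    apply: eq_bigr => i _; rewrite -actZ -actD; congr (act _ _).
    rewrite scaler_sumr -big_split; apply: eq_bigr => j _.
    by rewrite cD cZ mulrDr scalerAr.
  have /phiT/memv_imgP[m _ fm] : in_EndD act f.
    move=> d u; rewrite !fE linear_sum; apply: eq_bigr => i _.
    rewrite /= -(actM HU) mulr_suml; congr (act _ _); apply: eq_bigr => j _.
    by rewrite cA mulrA.
  exists m; apply/matrixP=> i j; rewrite mxE -fm fE cK.
  rewrite (bigD1 j) //= cv eqxx mulr1 big1 ?addr0 // => l lj.
  by rewrite cv (negPf lj) mulr0.
exists k, gamma, Phi; split.
- by exists Phi' => // m; apply: Phi_inj; rewrite Phi'K.
- split=> [x y|a x|x y]; apply/matrixP=> i j; rewrite !mxE.
  + by rewrite linearD add_lfunE cD.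
  + by rewrite linearZ scale_lfunE cZ.
  + by rewrite phiM comp_lfunE phi_c cK; apply: eq_bigr => l _; rewrite !mxE.
- move=> g x; apply: iff_trans (phiS g x) _; split=> [xg i j|xg y u uy].
    rewrite mxE -!hE; have := c_homog _ _ i (xg _ _ (vh j)).
    by rewrite addrC addrA.
  rewrite phi_c memv_suml // => i _.
  have -> : g + y = h i + (- h i + g + y) by rewrite !addrA subrr add0r.
  apply: (act_homog HU (vh i)); rewrite memv_suml // => j _.
  have := xg i j; rewrite -!hE => xij.
  have := homogM HD xij (c_homog _ _ j uy).
  have -> : - h i + g + h j + (y - h j) = - h i + g + y.
    by rewrite addrCA -addrA subrr addr0 addrC.
  exact: id.
Qed.

End EndMatrix.

(** * Central simple graded division algebras *)

Section MatrixAlgebra.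
Variables (F : closedFieldType) (N k : nat) (N_gt0 : (0 < N)%N) (D : falgType F).
Variables (Phi : 'M[F]_N -> 'M[D]_k) (Phi1 : 'M[D]_k -> 'M[F]_N).
Hypotheses (PhiK : cancel Phi Phi1) (Phi1K : cancel Phi1 Phi).
Hypothesis PhiD : forall x y, Phi (x + y) = Phi x + Phi y.
Hypothesis PhiZ : forall c x, Phi (c *: x) = map_mx ( *:%R c) (Phi x).
Hypothesis PhiM : forall x y, Phi (x *m y) = Phi x *m Phi y.

Let i0 : 'I_N := Ordinal N_gt0.

Lemma matrix_iso1 : Phi 1%:M = 1%:M.
Proof. by rewrite -[LHS]mulmx1 -[X in _ *m X]Phi1K -PhiM mul1mx Phi1K. Qed.

Let Phi0 : Phi 0 = 0.
Proof. by apply: (addIr (Phi 0)); rewrite -PhiD !add0r. Qed.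

Lemma matrix_iso_gt0 : (0 < k)%N.
Proof.
rewrite lt0n; apply/eqP => k0.
have /matrixP/(_ i0 i0)/eqP : 1%:M = 0 :> 'M[F]_N.
  apply: (can_inj PhiK); apply/matrixP=> i; have := ltn_ord i.
  by rewrite {2}k0.
by rewrite !mxE eqxx oner_eq0.
Qed.

Let r0 : 'I_k := Ordinal matrix_iso_gt0.

(** The scalar matrix of a central [x] is central in ['M[D]_k], so its image in ['M[F]_N] is
    central, hence scalar. *)
Lemma central_scalar (x : D) : (forall y, x * y = y * x) -> exists c, x = c%:A.
Proof.
move=> xC; pose m := Phi1 x%:M.
have mC y : m *m y = y *m m.
  apply: (can_inj PhiK); rewrite !PhiM Phi1K mul_scalar_mx.
  apply/matrixP=> i j; rewrite !mxE (bigD1 j) //= big1 => [|l lj].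
    by rewrite mxE eqxx mulr1n addr0 xC.
  by rewrite mxE (negPf lj) mulr0n mulr0.
have mE : m = (m i0 i0) *: 1%:M.
  apply/matrixP=> i j; have /matrixP/(_ i i0) := mC (delta_mx j i0).
  rewrite !mxE (bigD1 j) //= big1 => [|l lj]; last first.
    by rewrite mxE (negPf lj) mulr0.
  rewrite (bigD1 i0) //= big1 => [|l lj]; last by rewrite mxE (negPf lj) andbF mul0r.
  rewrite !mxE !eqxx !addr0 mulr1 andbT => ->.
  by rewrite mulrC; congr (_ * _); case: eqP.
exists (m i0 i0); have : Phi m = x%:M by rewrite /m Phi1K.
rewrite mE PhiZ matrix_iso1 => /matrixP/(_ r0 r0).
by rewrite !mxE !eqxx !mulr1n mulr1 => <-.
Qed.

(* An ideal of [D] gives the ideal of the matrices with entries in it, and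
   [M_N(F)] is simple. *)
Lemma matrix_iso_simple : is_simple_algebra D.
Proof.
move=> I II; have [|I0] := eqVneq I 0%VS; first by left.
right; apply/eqP; rewrite eqEsubv subvf /=; apply/subvP=> d _.
suff I1 : 1 \in I by have /andP[] := II d 1 I1; rewrite mulr1.
pose x := vpick I; have xI : x \in I by apply: memv_pick.
pose m := Phi1 x%:M.
have /matrix0Pn[i [j mij]] : m != 0.
  apply/eqP=> m0; have := Phi1K x%:M; rewrite -/m m0 Phi0 => /matrixP/(_ r0 r0)/eqP.
  by rewrite !mxE eqxx mulr1n eq_sym vpick0 (negPf I0).
(* A nonzero entry of [m] recovers the identity from [m] by matrix units. Applying [Phi] and reading
   one diagonal entry then writes 1 as an element of [I]. *)
have e1 : 1%:M =
    \sum_(r < N) (m i j)^-1 *: (delta_mx r i *m m *m delta_mx j r) :> 'M[F]_N.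
  apply/matrixP=> a c; rewrite summxE (bigD1 a) //= big1 => [|r ra].
    rewrite addr0 !mxE (bigD1 j) //= big1 => [|l lj]; last first.
      by rewrite !mxE (negPf lj) mulr0.
    rewrite !mxE (bigD1 i) //= big1 => [|l li]; last first.
      by rewrite !mxE (negPf li) andbF mul0r.
    rewrite !mxE !eqxx /= mul1r !addr0 mulrA mulVf // mul1r.
    by rewrite eq_sym.
  rewrite !mxE big1 ?mulr0 // => l _; rewrite !mxE big1 ?mul0r // => l' _.
  by rewrite !mxE eq_sym (negPf ra) mul0r.
have : Phi 1%:M = \sum_r map_mx ( *:%R (m i j)^-1)
    (Phi (delta_mx r i) *m x%:M *m Phi (delta_mx j r)).
  rewrite e1 (big_morph Phi PhiD Phi0); apply: eq_bigr => r _.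
  by rewrite PhiZ !PhiM Phi1K.
rewrite matrix_iso1 => /matrixP/(_ r0 r0); rewrite summxE mxE eqxx mulr1n => ->.
apply: memv_suml => r _; rewrite mxE memvZ // mxE memv_suml // => l _.
apply: (proj2 (andP (II _ _ _))); rewrite mxE memv_suml // => l' _.
apply: (proj1 (andP (II _ _ _))); rewrite mxE.
by case: eqP => _; rewrite ?mem0v.
Qed.

Lemma matrix_iso_dim : (N * N = k * k * \dim {:D})%N.
Proof.
have [E EE] : exists E : 'Hom('M[F]_N, {ffun 'I_k * 'I_k -> D}),
    forall m, E m = [ffun ij => Phi m ij.1 ij.2].
  apply: linear_hom => c x y; apply/ffunP=> ij.
  by rewrite !ffunE PhiD PhiZ !mxE.
have E0 : lker E == 0%VS.
  apply/lker0P=> x y; rewrite !EE => /ffunP xy; apply: (can_inj PhiK).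
  by apply/matrixP=> i j; have := xy (i, j); rewrite !ffunE.
have ET : limg E = fullv.
  apply/eqP; rewrite eqEsubv subvf /=; apply/subvP=> d _; apply/memv_imgP.
  exists (Phi1 (\matrix_(i, j) d (i, j))); first exact: memvf.
  by rewrite EE Phi1K; apply/ffunP=> -[i j]; rewrite ffunE mxE.
have := congr1 (fun W : {vspace _} => \dim W) ET.
rewrite /= limg_dim_eq ?(eqP E0) ?capv0 // !dimvf.
by rewrite /dim /= card_prod card_ord => ->.
Qed.

End MatrixAlgebra.

(** * Commutation factors as a nondegenerate bicharacter *)

Section Commutation.
Variables (F : closedFieldType) (K : zmodType) (D : falgType F).
Variable Dg : K -> {vspace D}.
Hypothesis HD : graded_division Dg.
Local Notation T := [pred t | Dg t != 0%VS].

Lemma support_fset : exists S : {fset K}, T =i [pred x in S].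
Proof.
have [s [p Hp]] := graded_division_projections HD.
exists [fset t in s | Dg t != 0%VS]%fset => t; rewrite !inE /=.
by apply/idP/idP=> [tT|/andP[]] //; rewrite tT andbT (homog_supp_mem Hp).
Qed.

Lemma dim_graded_division (S : {fset K}) : T =i [pred x in S] -> \dim {:D} = #|` S|.
Proof.
move=> TS; have [s [p Hp]] := graded_division_projections HD.
case: HD => -[[_ Ddir] _] _.
have <- : (\sum_(t <- S) Dg t)%VS = fullv.
  apply/eqP; rewrite eqEsubv subvf /=; apply/subvP=> x _.
  rewrite [x](proj_sum Hp) memv_suml // => t _.
  have := proj_mem Hp t x; have [tT|tT] := boolP (t \in S).
    by apply: subvP; rewrite (big_fsetD1 t tT) /= addvSl.
  have := TS t; rewrite !inE (negPf tT) => /negbFE/eqP->.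
  by rewrite memv0 => /eqP->; rewrite mem0v.
move/directvP: (Ddir S) => /= ->; rewrite cardfE -sum1_card big_seq_fsetE /=.
apply: eq_bigr => t _; apply: (dim_homog HD).
by have := TS (val t); rewrite !inE (valP t).
Qed.

(** Both products of nonzero [X] and [Y] lie in the line of degree [s + t]. When a component is zero
    any factor works, and 1 is taken. *)
Lemma commutation_exists : exists b : K -> K -> F,
  forall s t x y, x \in Dg s -> y \in Dg t -> x * y = b s t *: (y * x).
Proof.
suff /choice[b bP] : forall st : K * K, exists c : F,
    forall x y, x \in Dg st.1 -> y \in Dg st.2 -> x * y = c *: (y * x).
  by exists (fun s t => b (s, t)) => s t; apply: (bP (s, t)).
case=> s t /=; pose X := vpick (Dg s); pose Y := vpick (Dg t).
have Xs : X \in Dg s by apply: memv_pick.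
have Yt : Y \in Dg t by apply: memv_pick.
have [s0|s0] := eqVneq (Dg s) 0%VS.
  by exists 1 => x y; rewrite s0 memv0 => /eqP-> _; rewrite mul0r mulr0 scaler0.
have [t0|t0] := eqVneq (Dg t) 0%VS.
  by exists 1 => x y _; rewrite t0 memv0 => /eqP->; rewrite mul0r mulr0 scaler0.
rewrite -vpick0 -/X in s0; rewrite -vpick0 -/Y in t0.
have YX0 : Y * X != 0 by rewrite (homogM_eq0 HD Yt Xs) negb_or t0.
have YXst : Y * X \in Dg (s + t) by rewrite addrC; apply: (homogM HD Yt Xs).
have [c XY] := homog_line HD YXst YX0 (homogM HD Xs Yt).
exists c => x y /(homog_line HD Xs s0)[d ->] /(homog_line HD Yt t0)[d' ->].
by rewrite -!scalerAl -!scalerAr XY !scalerA; congr (_ *: _); ring.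
Qed.

Variable b : K -> K -> F.
Hypothesis bP : forall s t x y, x \in Dg s -> y \in Dg t -> x * y = b s t *: (y * x).

(** The identities follow by comparing coefficients of nonzero products. If [b r] is trivial on the
    support, then [X r] is central, hence a scalar of degree 0, and [r = 0]. *)
Lemma commutation_nondeg :
    (forall x : D, (forall y, x * y = y * x) -> exists c, x = c%:A) ->
  is_nondeg_alt_bichar T b.
Proof.
move=> central; have [s [p Hp]] := graded_division_projections HD.
pose X t := vpick (Dg t); have XD t : X t \in Dg t by apply: memv_pick.
have X0 t : t \in T -> X t != 0 by rewrite inE -vpick0.
have b0 : {in T &, forall s t, b s t != 0}.
  move=> r t rT tT; apply/eqP=> b0; have /eqP := bP (XD r) (XD t).
  by rewrite b0 scale0r (homogM_eq0 HD (XD r) (XD t)) (negPf (X0 _ rT)) (negPf (X0 _ tT)).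
have bV : {in T &, forall s t, b s t * b t s = 1}.
  move=> r t rT tT; apply/eqP; rewrite -subr_eq0.
  have /eqP := bP (XD r) (XD t); rewrite (bP (XD t) (XD r)) scalerA.
  rewrite -{1}[X r * X t]scale1r eq_sym -subr_eq0 -scalerBl scaler_eq0.
  by rewrite (homogM_eq0 HD (XD r) (XD t)) (negPf (X0 _ rT)) (negPf (X0 _ tT)) !orbF.
have bD : {in T & &, forall r t t', b r (t + t') = b r t * b r t'}.
  move=> r t t' rT tT tT'; apply/eqP; rewrite -subr_eq0.
  have Xtt' := homogM HD (XD t) (XD t').
  have /eqP := bP (XD r) Xtt'.
  rewrite mulrA (bP (XD r) (XD t)) -scalerAl -(mulrA (X t)).
  rewrite (bP (XD r) (XD t')) -scalerAr scalerA (mulrA (X t)).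
  rewrite eq_sym -subr_eq0 -scalerBl scaler_eq0.
  rewrite (homogM_eq0 HD Xtt' (XD r)) (homogM_eq0 HD (XD t) (XD t')).
  by rewrite (negPf (X0 _ rT)) (negPf (X0 _ tT)) (negPf (X0 _ tT')) !orbF.
have TZ := supp_zmod_closed HD.
have TD : {in T &, forall s t, s + t \in T}.
  move=> r t rT tT; rewrite -[t]opprK -(sub0r t); case: TZ => T0 TB.
  by apply: (TB) => //; apply: (TB).
split=> [r rT|t tT|r rT|r rT r1].
- by split=> [t tT|t t' tT tT']; [apply: b0 | apply: bD].
- split=> [r rT|r r' rT rT']; first exact: b0.
  apply: (mulfI (b0 _ _ tT (TD _ _ rT rT'))); rewrite bV ?TD // bD //.
  by rewrite mulrACA !bV // mulr1.
- apply/eqP; rewrite -subr_eq0; have /eqP := bP (XD r) (XD r).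
  rewrite -{1}[X r * X r]scale1r eq_sym -subr_eq0 -scalerBl scaler_eq0.
  by rewrite (homogM_eq0 HD (XD r) (XD r)) (negPf (X0 _ rT)) !orbF.
- have [c Xc] : exists c, X r = c%:A.
    apply: central => y; rewrite [y](proj_sum Hp) mulr_sumr mulr_suml.
    apply: eq_bigr => t _; have [tT|tT] := boolP (t \in T).
      by rewrite (bP (XD r) (proj_mem Hp t y)) r1 // scale1r.
    have := proj_mem Hp t y; move: tT; rewrite inE negbK => /eqP->.
    by rewrite memv0 => /eqP->; rewrite mulr0 mul0r.
  have Xr0 : X r \in Dg 0 by rewrite Xc memvZ // (homog1 HD).
  apply/eqP; apply: contraT => r0.
  by have := X0 _ rT; rewrite (homog_eq0 Hp (XD r) Xr0 r0) eqxx.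
Qed.

End Commutation.

(** * Parameters of an odd grading *)

Lemma double_card (V : zmodType) (P Q : {fset V}) (a : V) :
    (forall x, (x \in Q) = (x \in P) || (x - a \in P)) ->
    (forall x, x \in P -> x - a \notin P) ->
  #|` Q| = (#|` P| * 2)%N.
Proof.
move=> QE Pa; pose P' := [fset (x + a)%R | x in P]%fset.
have P'E x : (x \in P') = (x - a \in P).
  apply/imfsetP/idP=> [[y yP ->]|xP]; first by rewrite addrK.
  by exists (x - a); rewrite ?subrK.
have -> : Q = (P `|` P')%fset by apply/fsetP=> x; rewrite QE in_fsetU P'E.
rewrite cardfsU (_ : P `&` P' = fset0)%fset; last first.
  apply/fsetP=> x; rewrite in_fsetI P'E in_fset0; apply/negP=> /andP[xP].
  exact/negP/Pa.
by rewrite cardfs0 subn0 card_imfset ?muln2 ?addnn //; apply: addIr.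
Qed.

Section OddSupport.
Variables (F : closedFieldType) (G : zmodType).
Hypothesis F_char : 2%N \notin [pchar F].
Local Notation Gsharp := (G * 'Z_2)%type.
Variables (S : {fset Gsharp}) (b : Gsharp -> Gsharp -> F) (tau : Gsharp).
Hypotheses (SZ : zmod_closed [pred x in S]).
Hypothesis bP : is_nondeg_alt_bichar [pred x in S] b.
Hypotheses (tauS : tau \in S) (tau_odd : tau.2 = 1).

Lemma evenD (x y : G) : (x, 0) + (y, 0) = (x + y, 0) :> Gsharp.
Proof. by congr pair; apply: val_inj. Qed.

Lemma evenB (x y : G) : (x, 0) - (y, 0) = (x - y, 0) :> Gsharp.
Proof. by congr pair; apply: val_inj. Qed.

Let SB : {in S &, forall x y, x - y \in S}. Proof. by case: SZ. Qed.
Let S0 : 0 \in S. Proof. by case: SZ. Qed.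
Let SD : {in S &, forall x y, x + y \in S}.
Proof.
move=> x y xS yS; rewrite -[y]opprK; apply: (SB) => //.
by rewrite -sub0r; apply: (SB).
Qed.

Let bDl x y z : x \in S -> y \in S -> z \in S -> b (x + y) z = b x z * b y z.
Proof. by move=> xS yS zS; case: bP => _ br _ _; have [_] := br z zS; apply. Qed.

Let bDr x y z : x \in S -> y \in S -> z \in S -> b z (x + y) = b z x * b z y.
Proof. by move=> xS yS zS; case: bP => bl _ _ _; have [_] := bl z zS; apply. Qed.

Let b_neq0 x y : x \in S -> y \in S -> b x y != 0.
Proof. by move=> xS yS; case: bP => bl _ _ _; have [+ _] := bl x xS; apply. Qed.

Let bBl x y z : x \in S -> y \in S -> z \in S -> b (x - y) z = b x z / b y z.
Proof.
move=> xS yS zS; case: bP => _ br _ _; have [_ bD] := br z zS.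
have NyS : - y \in S by rewrite -sub0r; apply: (SB).
by rewrite bD // (characterN SZ (br z zS)).
Qed.

Let oneN1 : 1 != -1 :> F.
Proof.
rewrite -subr_eq0 opprK; apply: contra F_char => e.
by rewrite inE /= mulr2n.
Qed.

(* Nondegeneracy on [S] makes the parity character a value of [b]; the element
   representing it generates the radical of the restriction of [b] to the even
   part of [S]. *)
Lemma parity_element : exists t0 : G,
  [/\ has_order2 t0, (t0, 0) \in S
    & forall x, x \in S -> b (t0, 0) x = if x.2 == 0 then 1 else -1].
Proof.
have parP : is_character [pred x in S] (fun x : Gsharp => if x.2 == 0 then 1 else -1 : F).
  split=> [x _|x y _ _]; first by case: ifP => _; rewrite ?oppr_eq0 oner_eq0.
  case: x y => x i [y j] /=.
  by case: (Z2_cases i) => ->; case: (Z2_cases j) => -> /=; rewrite ?mulrNN ?mulr1 ?mul1r.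
have [[t0 i] sS sE] := nondeg_bichar_character SZ bP parP.
(* An odd representing element would pair with itself to -1, whereas alternation gives 1, and these
   differ outside characteristic 2. *)
have i0 : i = 0.
  case: (Z2_cases i) => // i1; case: bP => _ _ balt _.
  by have := sE _ sS; rewrite balt //= i1 /= => /esym/eqP; rewrite (negPf oneN1).
rewrite {}i0 in sS sE; exists t0; split=> // [|x xS]; last by rewrite -sE.
split.
  apply: contraTneq isT => t00; have := sE _ tauS; rewrite tau_odd t00 /=.
  case: bP => _ br _ _; rewrite (character0 S0 (br _ tauS)) => /esym/eqP.
  by rewrite (negPf oneN1).
have : (t0, 0) + (t0, 0) = 0 :> Gsharp.
  case: bP => _ _ _; apply=> [|y yS]; first exact: SD.
  by rewrite bDl // -sE //; case: ifP => _; rewrite ?mulrNN mulr1.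
by move/(congr1 fst); rewrite /= -mulr2n.
Qed.

Variable t0 : G.
Hypotheses (t0_2 : has_order2 t0) (t0S : (t0, 0) \in S).
Hypothesis t0P : forall x, x \in S -> b (t0, 0) x = if x.2 == 0 then 1 else -1.

Lemma even_cyc x t : x \in cyc t0 -> (t, 0) \in S -> b (x, 0) (t, 0) = 1.
Proof.
move=> /(cycP t0_2)[] -> tS; last by rewrite t0P.
by case: bP => _ br _ _; rewrite (character0 S0 (br _ tS)).
Qed.

Lemma cyc_even x : x \in cyc t0 -> (x, 0) \in S.
Proof. by move=> /(cycP t0_2)[] ->. Qed.

Lemma odd_sub x : x \in S -> x.2 = 1 -> exists2 s, (s, 0) \in S & x = (s, 0) + tau.
Proof.
move=> xS x1; exists (x.1 - tau.1).
  have -> : (x.1 - tau.1, 0) = x - tau.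
    rewrite [x]surjective_pairing [tau]surjective_pairing x1 tau_odd.
    by congr pair; apply: val_inj.
  exact: SB.
rewrite [LHS]surjective_pairing [tau in RHS]surjective_pairing x1 tau_odd.
by congr pair; rewrite /= ?subrK ?add0r.
Qed.

(** Since [tau + tau] is even, [b (x, 0) tau] has square 1. If it is 1, then [(x, 0)] is in the
    radical of [b]; if it is -1, then [(x - t0, 0)] is. *)
Lemma even_radical x : (x, 0) \in S ->
  (forall t, (t, 0) \in S -> b (x, 0) (t, 0) = 1) -> x \in cyc t0.
Proof.
move=> xS x1; apply/(cycP t0_2).
have tt : exists2 s, (s, 0) \in S & tau + tau = (s, 0).
  exists (tau.1 + tau.1).
    have -> : (tau.1 + tau.1, 0) = tau + tau.
      by rewrite [tau]surjective_pairing tau_odd; congr pair; apply: val_inj.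
    exact: SD.
  by rewrite [tau]surjective_pairing tau_odd; congr pair; apply: val_inj.
have [s sS ttE] := tt.
have : b (x, 0) tau ^+ 2 == 1 by rewrite expr2 -bDr // ttE x1.
rewrite sqrf_eq1 => /orP[/eqP|/eqP] xt.
- left; have : (x, 0) = 0 :> Gsharp; last by case.
  case: bP => _ _ _; apply=> // -[y i] yS; case: (Z2_cases i) => iE.
    by rewrite iE in yS *; apply: x1.
  have [r rS ->] := odd_sub yS iE.
  by rewrite bDr // x1 // xt mul1r.
- right; have : (x, 0) - (t0, 0) = 0 :> Gsharp; last first.
    by move/(congr1 fst)/eqP; rewrite /= subr_eq0 => /eqP.
  case: bP => _ _ _; apply=> [|[y i] yS]; first exact: SB.
  rewrite bBl // t0P //=; case: (Z2_cases i) => iE; rewrite iE /=.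
    by rewrite iE in yS; rewrite x1 // divr1.
  have [r rS yE] := odd_sub yS iE; rewrite -iE yE.
  by rewrite bDr // x1 // xt mul1r divff // oppr_eq0 oner_eq0.
Qed.

Definition odd_Tbar : {fset Gbar t0} := [fset bar t0 x.1 | x in S & x.2 == 0]%fset.
(** The choice of representatives is harmless, as [odd_betaE] shows: they differ by elements of
    [cyc t0], which pair trivially with the even part. *)
Definition odd_beta (y z : Gbar t0) : F := b (repr y, 0) (repr z, 0).

Lemma odd_Tplus x : (x \in Tplus odd_Tbar) = ((x, 0) \in S).
Proof.
rewrite mem_Tplus; apply/imfsetP/idP => [[[y i]]|xS]; last first.
  by exists (x, 0); rewrite //= inE xS.
rewrite !inE /= => /andP[yS /eqP i0] /eqP; rewrite bar_eq => xy.
by rewrite -(subrK y x) -evenD; apply: SD; [apply: cyc_even | rewrite i0 in yS].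
Qed.

Lemma odd_Tbar_repr y : (y \in odd_Tbar) = ((repr y, 0) \in S).
Proof. by rewrite -odd_Tplus mem_Tplus bar_repr. Qed.

Lemma odd_Tbar_zmod_closed : zmod_closed [pred y in odd_Tbar].
Proof.
split=> [|y z]; first by rewrite inE -(bar0 t0) -mem_Tplus odd_Tplus.
rewrite !inE -[y]bar_repr -[z]bar_repr -barB -!mem_Tplus !odd_Tplus -evenB.
exact: SB.
Qed.

Lemma odd_betaE s t : (s, 0) \in S -> (t, 0) \in S ->
  betaplus odd_beta s t = b (s, 0) (t, 0).
Proof.
move=> sS tS; rewrite /betaplus /odd_beta.
have reprE (x : G) : (x, 0) \in S -> exists2 e, e \in cyc t0 &
    (repr (bar t0 x), 0) = (e, 0) + (x, 0) :> Gsharp.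
  move=> xS; exists (repr (bar t0 x) - x); last by rewrite evenD subrK.
  by rewrite -bar_eq bar_repr.
have [e eC ->] := reprE s sS; have [f fC ->] := reprE t tS.
have [eS fS] := (cyc_even eC, cyc_even fC).
rewrite bDl ?SD // [b (e, 0) _]bDr // !(even_cyc eC) // !mul1r bDr //.
by rewrite (alt_bicharV SZ bP fS sS) (even_cyc fC) // invr1 mul1r.
Qed.

Lemma odd_beta_nondeg : is_nondeg_alt_bichar [pred y in odd_Tbar] odd_beta.
Proof.
have mulE (y z w : Gbar t0) : y \in odd_Tbar -> z \in odd_Tbar -> w \in odd_Tbar ->
    odd_beta y (z + w) = odd_beta y z * odd_beta y w /\
    odd_beta (z + w) y = odd_beta z y * odd_beta w y.
  rewrite !odd_Tbar_repr => yS zS wS.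
  have zwS : (repr z + repr w, 0) \in S by rewrite -evenD; apply: SD.
  have := odd_betaE yS zwS; have := odd_betaE zwS yS.
  rewrite /betaplus barD !bar_repr => -> ->.
  by rewrite -evenD bDl // bDr.
split=> [y|y|y|y]; rewrite !inE => yT.
- split=> [z|z w]; rewrite !inE => zT.
    by rewrite b_neq0 // -odd_Tbar_repr.
  by move=> wT; have [] := mulE y z w yT zT wT.
- split=> [z|z w]; rewrite !inE => zT.
    by rewrite b_neq0 // -odd_Tbar_repr.
  by move=> wT; have [] := mulE y z w yT zT wT.
- by case: bP => _ _ balt _; apply: balt; rewrite inE -odd_Tbar_repr.
- move=> y1; rewrite -[y]bar_repr; apply/eqP; rewrite bar_eq0.
  apply: even_radical => [|t tS]; first by rewrite -odd_Tbar_repr.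
  rewrite -odd_betaE -?odd_Tbar_repr // /betaplus bar_repr y1 //.
  by rewrite inE -mem_Tplus odd_Tplus.
Qed.

Variable chi : forall t0 : G, {fset Gbar t0} -> G -> F.
Hypothesis chi_fixed : is_choice_of_characters chi.

(** The quotient of [chi] by [b tau] is 1 at [t0], where both are -1, so it descends to [odd_Tbar]
    and is represented there by some [y]. Translating [tau] by [y] gives the required odd
    element. *)
Lemma odd_u_exists : exists u : G,
  (u, 1) \in S /\ forall t, (t, 0) \in S -> b (u, 1) (t, 0) = chi odd_Tbar t.
Proof.
have [[chi0 chiD] chit0] := chi_fixed t0_2 odd_Tbar_zmod_closed.
pose c x := chi odd_Tbar x / b tau (x, 0).
have c0 x : (x, 0) \in S -> c x != 0.
  by move=> xS; rewrite mulf_neq0 ?invr_eq0 ?b_neq0 ?chi0 ?odd_Tplus.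
have cD x y : (x, 0) \in S -> (y, 0) \in S -> c (x + y) = c x * c y.
  move=> xS yS; rewrite /c chiD ?odd_Tplus // -evenD bDr // invfM.
  by rewrite mulrACA.
have c_cyc e : e \in cyc t0 -> c e = 1.
  move=> /(cycP t0_2)[] ->.
    by apply: (mulfI (c0 0 S0)); rewrite -cD // addr0 mulr1.
  rewrite /c chit0 (alt_bicharV SZ bP t0S tauS) t0P // tau_odd /=.
  by rewrite invrK mulrNN mulr1.
have cE x : (x, 0) \in S -> c (repr (bar t0 x)) = c x.
  move=> xS; have e : repr (bar t0 x) - x \in cyc t0 by rewrite -bar_eq bar_repr.
  have := cD _ _ (cyc_even e) xS; rewrite subrK => ->.
  by rewrite c_cyc // mul1r.
have cP : is_character [pred y in odd_Tbar] (fun y => c (repr y)).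
  split=> [y|y z]; rewrite !inE !odd_Tbar_repr => yS; first exact: c0.
  move=> zS; rewrite -cD // -(cE (repr y + repr z)) -?evenD ?SD //.
  by rewrite barD !bar_repr.
have [y] := nondeg_bichar_character odd_Tbar_zmod_closed odd_beta_nondeg cP.
rewrite odd_Tbar_repr => yS yE; exists (tau.1 + repr y).
have -> : (tau.1 + repr y, 1) = tau + (repr y, 0) :> Gsharp.
  by rewrite [tau in RHS]surjective_pairing tau_odd; congr pair; rewrite addr0.
split=> [|t tS]; first exact: SD.
rewrite bDl // -(odd_betaE yS tS) /betaplus bar_repr -yE; last first.
  by rewrite odd_Tbar_repr -odd_Tplus mem_Tplus bar_repr -mem_Tplus odd_Tplus.
by rewrite cE // mulrC divfK // b_neq0.
Qed.

(** One factor 2 counts parities, through translation by [tau]; the other counts elements of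
    [cyc t0], through translation by [t0] of the set [R] of chosen representatives. *)
Lemma odd_card : #|` S| = (4 * #|` odd_Tbar|)%N.
Proof.
pose E := [fset x in S | x.2 == 0]%fset.
pose R := [fset ((repr y, 0) : Gsharp) | y in odd_Tbar]%fset.
have EE x : (x \in E) = (x \in S) && (x.2 == 0) by rewrite !inE.
have RE x : (x \in R) = [&& x.2 == 0, repr (bar t0 x.1) == x.1 & x \in S].
  apply/imfsetP/idP=> [[y yT ->]|].
    by rewrite /= bar_repr !eqxx -odd_Tbar_repr.
  case: x => x i /= /and3P[/eqP-> /eqP xE xS].
  by exists (bar t0 x); rewrite ?xE //= -mem_Tplus odd_Tplus.
have -> : #|` S| = (#|` E| * 2)%N.
  apply: (double_card (a := tau)) => [x|x]; rewrite !EE; last first.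
    case/andP=> _ /eqP x0; rewrite negb_and; apply/orP; right.
    by rewrite /= x0 tau_odd.
  case: (Z2_cases x.2) => xE; rewrite /= xE tau_odd /= ?andbT ?andbF ?orbF //=.
  by apply/idP/idP=> xS; [apply: SB | rewrite -(subrK tau x); apply: SD].
have -> : #|` E| = (#|` R| * 2)%N.
  apply: (double_card (a := (t0, 0))) => [[x i]|[x i]]; rewrite ?EE !RE /=; last first.
    case/and3P=> /eqP-> /eqP xE _; rewrite barB bar_t0 // !subr0 xE.
    rewrite -subr_eq0 opprB addrCA subrr addr0; case: t0_2 => /negPf-> _.
    by rewrite andbF.
  rewrite barB bar_t0 // !subr0; case: (Z2_cases i) => ->; rewrite /= ?andbF ?andbT //.
  rewrite [(x, 0) - _]evenB.
  have -> : ((x - t0, 0) \in S) = ((x, 0) \in S).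
    rewrite -evenB; apply/idP/idP=> xS; last exact: SB.
    by rewrite -(subrK (t0, 0) (x, 0)); apply: SD.
  rewrite -andb_orl; case: ((x, 0) \in S); rewrite ?andbF ?andbT //; apply/esym.
  have : repr (bar t0 x) - x \in cyc t0 by rewrite -bar_eq bar_repr.
  case/(cycP t0_2)=> /eqP; first by rewrite subr_eq0 => ->.
  rewrite subr_eq addrC => /eqP ->.
  have -> : x - t0 = x + t0.
    congr (_ + _); apply/eqP; rewrite -subr_eq0 -opprD -mulr2n.
    by case: t0_2 => _ ->; rewrite oppr0.
  by rewrite eqxx orbT.
have -> : #|` R| = #|` odd_Tbar|.
  apply: card_imfset => y z /(congr1 fst) /= yz.
  by rewrite -[y]bar_repr yz bar_repr.
by rewrite -mulnA mulnC.
Qed.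

Variable u : G.
Hypothesis uS : (u, 1) \in S.
Hypothesis uP : forall t, (t, 0) \in S -> b (u, 1) (t, 0) = chi odd_Tbar t.

Lemma odd_T_u : T_u odd_Tbar u =i [pred x in S].
Proof.
case=> x i; rewrite mem_T_u [RHS]inE; case: (Z2_cases i) => -> /=; rewrite odd_Tplus //.
have uE : (x, 1) - (u, 1) = (x - u, 0) :> Gsharp by congr pair; apply: val_inj.
rewrite -uE; apply/idP/idP=> xS; last exact: SB.
by rewrite -(subrK (u, 1) (x, 1)); apply: SD.
Qed.

Lemma odd_is_beta_u : is_beta_u chi odd_Tbar odd_beta u b.
Proof.
split.
- by apply: nondeg_alt_bichar_congr bP => x; rewrite odd_T_u.
- by move=> s t; rewrite !odd_Tplus => sS tS; rewrite odd_betaE.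
- by move=> t; rewrite odd_Tplus; apply: uP.
Qed.

(** Doubling [(u, 1)] gives the even element [(u *+ 2, 0)], so its pairings are squares of values of
    [chi], and its pairing with [(u, 1)] is 1 by alternation. *)
Lemma odd_element_a : is_element_a chi odd_Tbar odd_beta (u *+ 2).
Proof.
have uuE : (u *+ 2, 0) = (u, 1) + (u, 1) :> Gsharp.
  by rewrite mulr2n; congr pair; apply: val_inj.
have uuS : (u *+ 2, 0) \in S by rewrite uuE SD.
split=> [||t]; rewrite ?odd_Tplus //.
  rewrite -uP // uuE bDr //; case: bP => _ _ balt _.
  by rewrite balt // mulr1.
by move=> tS; rewrite odd_betaE // -uP // uuE bDl // expr2.
Qed.

End OddSupport.

(** * Existence of parameters and the classification *)

Lemma odd_grading_Gamma (F : closedFieldType) (F_char : 2%N \notin [pchar F])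
    (G : zmodType) (n : nat) (n_ge1 : (1 <= n)%N)
    (chi : forall t0 : G, {fset Gbar t0} -> G -> F)
    (chi_fixed : is_choice_of_characters chi) (A : G -> {vspace 'M[F]_(n + n)}) :
  is_odd_grading A ->
  exists (t0 : G) (Tbar : {fset Gbar t0}) (beta : Gbar t0 -> Gbar t0 -> F)
         (u : G) (k : nat) (gamma : k.-tuple G),
    admissible n chi Tbar beta u k /\ is_Gamma chi Tbar beta u gamma A.
Proof.
case=> HA [D [Dg [U [act [Ug [phi [HD HU phiP odd]]]]]]].
have [k [gamma [Phi [[Phi1 PhiK Phi1K] [PhiD PhiZ PhiM] PhiP]]]] :=
  EndD_matrix HD HU phiP odd.
have N_gt0 : (0 < n + n)%N by rewrite addn_gt0 n_ge1.
have [b bP] := commutation_exists HD.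
have [S TS] := support_fset HD.
have bnd := nondeg_alt_bichar_congr TS (commutation_nondeg HD bP
  (central_scalar N_gt0 PhiK Phi1K PhiZ PhiM)).
have SZ : zmod_closed [pred x in S].
  have [T0 TB] := supp_zmod_closed HD.
  by split=> [|x y]; rewrite -!TS //; apply: TB.
have [tau tauS tau_odd] : exists2 tau, tau \in S & tau.2 = 1.
  apply: contrapT => nt; apply: odd => t tD; case: (Z2_cases t.2) => // t1.
  by case: nt; exists t => //; have := TS t; rewrite !inE tD => <-.
have [t0 [t0_2 t0S t0P]] := parity_element F_char SZ bnd tauS tau_odd.
have [u [uS uP]] := odd_u_exists SZ bnd tauS tau_odd t0_2 t0S t0P chi_fixed.
exists t0, (odd_Tbar S t0), (odd_beta b (t0 := t0)), u, k, gamma.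
(* The dimension of ['M[F]_(n + n)] gives [4 n^2 = k^2 dim D], and [dim D] is four times the order
   of [odd_Tbar]. *)
have cardE : (n * n = k * k * #|` odd_Tbar S t0|)%N.
  have := matrix_iso_dim PhiK Phi1K PhiD PhiZ.
  rewrite (dim_graded_division HD TS) (odd_card SZ tauS tau_odd t0_2 t0S).
  by move=> e; apply/eqP; rewrite -(eqn_pmul2l (isT : 0 < 4)%N); apply/eqP; lia.
split.
  split=> //.
  - exact: (odd_Tbar_zmod_closed SZ t0_2 t0S).
  - exact: (odd_beta_nondeg SZ bnd tauS tau_odd t0_2 t0S t0P).
  - by exists (u *+ 2) => //; apply: (odd_element_a SZ bnd t0_2 t0S t0P uS uP).
  - have k0 := matrix_iso_gt0 N_gt0 PhiK.
    (* [k^2] divides [n^2], so [k] divides [n], and [n %/ k] is the required square root. *)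
    have kn : (k %| n)%N.
      by rewrite -(dvdn_pexp2r _ _ (isT : 0 < 2)%N) -!mulnn cardE dvdn_mulr.
    exists (n %/ k)%N; last by rewrite mulnC divnK.
    apply/eqP; rewrite -(eqn_pmul2l (_ : 0 < k * k)%N) ?muln_gt0 ?k0 //.
    by rewrite -cardE -mulnn mulnACA (mulnC k) divnK.
split=> //; exists b, D, Dg, Phi; split=> //; last by exists Phi1.
- exact: (odd_is_beta_u SZ bnd t0_2 t0S t0P uS uP).
- split=> // [|t|t|s t].
  + exact: (matrix_iso_simple N_gt0 PhiK Phi1K PhiD PhiZ PhiM).
  + by rewrite odd_T_u // -TS inE.
  + by rewrite odd_T_u // -TS inE => /(dim_homog HD).
  + by move=> _ _ x y; apply: bP.
Qed.

Lemma gradings_isomorphic_refl (F : fieldType) (G : zmodType) (n : nat)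
  (A : G -> {vspace 'M[F]_(n + n)}) : gradings_isomorphic A A.
Proof.
exists \1%VF; split=> [|x y|i|g]; rewrite ?lim1g // ?id_lfunE //.
by apply/lker0P=> x y; rewrite !id_lfunE.
Qed.

Theorem theorem4p20 (F : closedFieldType) (F_char : 2%N \notin [pchar F])
    (G : zmodType) (n : nat) (n_ge1 : (1 <= n)%N)
    (chi : forall t0 : G, {fset Gbar t0} -> G -> F)
    (chi_fixed : is_choice_of_characters chi) :
  (forall A : G -> {vspace 'M[F]_(n + n)}, is_odd_grading A ->
     exists (t0 : G) (Tbar : {fset Gbar t0}) (beta : Gbar t0 -> Gbar t0 -> F)
            (u : G) (k : nat) (gamma : k.-tuple G),
       admissible n chi Tbar beta u k /\
       exists2 B, is_Gamma chi Tbar beta u gamma B & gradings_isomorphic A B)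
  /\
  (forall (t0 : G) (Tbar : {fset Gbar t0}) (beta : Gbar t0 -> Gbar t0 -> F)
          (u : G) (k : nat) (gamma : k.-tuple G)
          (t0' : G) (Tbar' : {fset Gbar t0'})
          (beta' : Gbar t0' -> Gbar t0' -> F)
          (u' : G) (k' : nat) (gamma' : k'.-tuple G)
          (A A' : G -> {vspace 'M[F]_(n + n)}),
     admissible n chi Tbar beta u k ->
     admissible n chi Tbar' beta' u' k' ->
     is_Gamma chi Tbar beta u gamma A ->
     is_Gamma chi Tbar' beta' u' gamma' A' ->
     (gradings_isomorphic A A' <->
      same_parameters Tbar beta u gamma Tbar' beta' u' gamma')).
Proof.
split=> [A /(odd_grading_Gamma F_char n_ge1 chi_fixed)|].
  move=> [t0 [Tbar [beta [u [k [gamma [adm HA]]]]]]].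
  exists t0, Tbar, beta, u, k, gamma; split=> //.
  by exists A; [|apply: gradings_isomorphic_refl].
move=> t0 Tbar beta u k gamma t0' Tbar' beta' u' k' gamma' A A' adm adm' HA HA'.
split; first exact: (isomorphic_same_parameters n_ge1 adm adm' HA HA').
exact: (same_parameters_isomorphic n_ge1 adm adm' HA HA').
Qed.
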